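(* Let $P$ be a finite poset with $|P|\ge2$, connected Hasse diagram, and a maximum element $\hat1$, and let $\ell(P)$ be its length. Then $U_P$ is Gorenstein if and only if for all $0\le k\le\ell(P)-1$ the following hold: (1) $M_{P/{\sim}^k}$ is acyclic; (2) $P/{\sim}^k$ satisfies the tree downset condition.
   Context: $\ell(P)$ is the maximum length (number of elements minus one) of a chain in $P$. For a poset $Q$ (identified with $[m]$), $U_Q$ is the affine toric variety of the braid cone $\sigma_Q=\{x\in\mathbb{R}^m/\mathbb{R}(1,\dots,1): x_i\le x_j\text{ whenever } i<_Qj\}$ over the lattice $\mathbb{Z}^m/\mathbb{Z}(1,\dots,1)$; it is Gorenstein if some dual lattice vector pairs to $1$ with every ray generator of $\sigma_Q$. For a poset $Q$, $M_Q=\{x\in Q:\text{every } y\text{ covered by } x\text{ is minimal}\}$ (induced subposet), acyclic if its undirected Hasse diagram has no cycle. For $S\subseteq Q$, $cc(S)$ is the number of connected components of the subgraph of the undirected Hasse diagram of $Q$ induced on $S$, and $\downarrow S$ the downset generated by $S$. Tree downset condition for $Q$ (with $M_Q$ acyclic with $k$ components): for every $S\subseteq Q\setminus M_Q$ with $1\le|S|\le k$, letting $T_1,\dots,T_m$ be the components of $M_Q$ meeting $\downarrow S$ and $A_j$ the downset generated by $S\cup\bigcup_{i\ne j}T_i$, one has $cc(A_j\cap M_Q)=m$ whenever $cc(A_j)=1$. Tree relation on $Q$ (with $M_Q$ acyclic): $x\sim y$ iff $x=y$ or $x,y$ are in the same connected component of $M_Q$; $Q/{\sim}$ is the set of classes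 ordered by $X\le Y$ iff $x\le y$ for some $x\in X,y\in Y$ (a partial order). Iterates: $P/{\sim}^0=P$ and $P/{\sim}^k=(P/{\sim}^{k-1})/{\sim}$ (the tree relation being taken on $P/{\sim}^{k-1}$). *)

(* Defs.v *)
From HB Require Import structures.
From mathcomp Require Import all_boot all_order all_algebra.
From mathcomp Require Import reals.

Set Implicit Arguments.
Unset Strict Implicit.
Unset Printing Implicit Defensive.

Import Order.TTheory GRing.Theory Num.Theory.

Section ToricCones.
Local Open Scope ring_scope.
Variables (R : realType) (V : lmodType R) (N : zmodType).
(* [emb] is the map from the lattice [N] to the real vector space [V]. *)
Variables (emb : N -> V) (sigma : V -> Prop).

Definition in_dual_cone (u : {linear V -> R^o}) : Prop :=
  forall x, sigma x -> 0 <= u x.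

Definition is_face (F : V -> Prop) : Prop :=
  exists2 u : {linear V -> R^o}, in_dual_cone u &
    forall x, F x <-> sigma x /\ u x = 0.

(* The linear span of [F] is a line. *)
Definition one_dimensional (F : V -> Prop) : Prop :=
  exists x, [/\ F x, x != 0 & forall y, F y -> exists c : R, y = c *: x].

Definition is_ray (F : V -> Prop) : Prop := is_face F /\ one_dimensional F.

(* The ray generator of a ray [F] is the generator of the semigroup of lattice
   points of [F]. *)
Definition is_ray_generator (v : N) : Prop :=
  exists F, [/\ is_ray F, F (emb v) &
    forall w, F (emb w) -> exists n : nat, w = v *+ n].

Definition gorenstein_cone : Prop :=
  exists u : {additive N -> int}, forall v, is_ray_generator v -> u v = 1.

End ToricCones.

Section ModConst.
Local Open Scope ring_scope.
Local Open Scope quotient_scope.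
Variables (T : finType) (A : comNzRingType).

(* The multiples of (1,...,1). *)
Definition const_ffun : {pred {ffun T -> A}} :=
  [pred f : {ffun T -> A} | [forall i, forall j, f i == f j]].

Lemma const_ffunP (f : {ffun T -> A}) : reflect (forall i j, f i = f j) (f \in const_ffun).
Proof.
apply: (iffP forallP) => [H i j|H i]; first by move/forallP: (H i) => /(_ j)/eqP.
by apply/forallP => j; rewrite (H i j).
Qed.

Fact const_ffun_zmod_closed : zmod_closed const_ffun.
Proof.
split=> [|f g /const_ffunP Hf /const_ffunP Hg]; apply/const_ffunP => i j.
  by rewrite !ffunE.
by rewrite !ffunE (Hf i j) (Hg i j).
Qed.
HB.instance Definition _ :=
  GRing.isZmodClosed.Build {ffun T -> A} const_ffun const_ffun_zmod_closed.

(* A^T / A(1,...,1) *)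
Definition mod_const : Type := Quotient.quot const_ffun.
HB.instance Definition _ := GRing.Zmodule.on mod_const.
HB.instance Definition _ :=
  ZmodQuotient.copy mod_const (Quotient.quot const_ffun).

Lemma mod_const_eqP (f g : {ffun T -> A}) :
  reflect (forall i j, f i - g i = f j - g j)
          (\pi_mod_const f == \pi_mod_const g).
Proof.
rewrite -Quotient.idealrBE.
apply: (iffP (const_ffunP _)) => H i j; have := H i j; by rewrite !ffunE.
Qed.

Definition mod_const_scale (a : A) (x : mod_const) : mod_const :=
  \pi [ffun i => a * repr x i].

Lemma pi_mod_const_scale a (f : {ffun T -> A}) :
  mod_const_scale a (\pi_mod_const f) = \pi [ffun i => a * f i].
Proof.
apply/eqP/mod_const_eqP => i j; rewrite !ffunE -!mulrBr; congr (a * _).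
by have /eqP/mod_const_eqP := reprK (\pi_mod_const f); apply.
Qed.

Fact mod_const_scaleA a b x :
  mod_const_scale a (mod_const_scale b x) = mod_const_scale (a * b) x.
Proof.
rewrite -[x]reprK [mod_const_scale b _]pi_mod_const_scale !pi_mod_const_scale.
by apply: (congr1 \pi_mod_const); apply/ffunP => i; rewrite !ffunE mulrA.
Qed.

Fact mod_const_scale1 : left_id 1 mod_const_scale.
Proof.
move=> x; rewrite -[x]reprK pi_mod_const_scale.
by apply: (congr1 \pi_mod_const); apply/ffunP => i; rewrite !ffunE mul1r.
Qed.

Fact mod_const_scaleDr : right_distributive mod_const_scale +%R.
Proof.
move=> a x y; rewrite -[x]reprK -[y]reprK -raddfD !pi_mod_const_scale -raddfD.
by apply: (congr1 \pi_mod_const); apply/ffunP => i; rewrite !ffunE mulrDr.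
Qed.

Fact mod_const_scaleDl x :
  {morph mod_const_scale^~ x : a b / a + b}.
Proof.
move=> a b; rewrite -[x]reprK !pi_mod_const_scale -raddfD.
by apply: (congr1 \pi_mod_const); apply/ffunP => i; rewrite !ffunE mulrDl.
Qed.

HB.instance Definition _ := GRing.Zmodule_isLmodule.Build A mod_const
  mod_const_scaleA mod_const_scale1 mod_const_scaleDr mod_const_scaleDl.

End ModConst.

Section BraidCone.
Local Open Scope quotient_scope.
Variables (R : realType) (d : Order.disp_t) (Q : finPOrderType d).

(* Z^Q / Z(1,...,1) -> R^Q / R(1,...,1) *)
Definition lattice_emb (v : mod_const Q int) : mod_const Q R :=
  \pi [ffun i => (repr v i)%:~R%R].

(* Two representatives of [x] differ by a constant, so the choice of [repr x]
   is immaterial. *)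
Definition braid_cone (x : mod_const Q R) : Prop :=
  forall i j : Q, (i < j)%O -> (repr x i <= repr x j)%R.

(* The affine toric variety of the braid cone of [Q] is Gorenstein. *)
Definition gorenstein : Prop := gorenstein_cone lattice_emb braid_cone.

End BraidCone.

Section Graphs.
Variable T : finType.

Definition induced (e : rel T) (S : {set T}) : rel T :=
  [rel x y | [&& x \in S, y \in S & e x y]].

(* Vertex sets of the connected components of the subgraph of [e] induced on
   [S]. *)
Definition components (e : rel T) (S : {set T}) : {set {set T}} :=
  equivalence_partition (connect (induced e S)) S.

Lemma induced_connect_sym (e : rel T) (S : {set T}) :
  symmetric e -> connect_sym (induced e S).
Proof.
by move=> se; apply: sym_connect_sym => x y; rewrite /induced /= se andbCA.
Qed.

Lemma same_componentE (e : rel T) (S : {set T}) (x y : T) : symmetric e ->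
  [exists U in components e S, (x \in U) && (y \in U)] =
  [&& x \in S, y \in S & connect (induced e S) x y].
Proof.
move=> se; apply/existsP/and3P.
  case=> U /and3P[/imsetP[z zS ->]]; rewrite !inE => /andP[xS zx] /andP[yS zy].
  by split=> //; apply: connect_trans zy; rewrite induced_connect_sym.
move=> [xS yS xy]; exists [set w in S | connect (induced e S) x w].
rewrite !inE xS yS xy connect0 !andbT.
by apply/imsetP; exists x.
Qed.

(* A simple graph is a symmetric relation [e]; its cycles have at least three
   vertices, whereas [ucycle] also accepts a single edge walked both ways. *)
Definition acyclic (e : rel T) : Prop :=
  forall c : seq T, 2 < size c -> ~ ucycle e c.

End Graphs.

Section Posets.
Local Open Scope order_scope.
Variables (d : Order.disp_t) (Q : finPOrderType d).
Implicit Types (x y z : Q) (S : {set Q}).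

Definition is_chain S : bool := [forall x in S, forall y in S, x >=< y].

Definition poset_length : nat := (\max_(S : {set Q} | is_chain S) #|S|.-1)%N.

Definition minimal x : bool := [forall y, ~~ (y < x)].

(* [y] covers [x] in the induced subposet [S]. *)
Definition covered_in S x y : bool :=
  [&& x \in S, y \in S, x < y & [forall z in S, ~~ (x < z < y)]].

(* The undirected Hasse diagram of the induced subposet [S]. *)
Definition hasse_in S : rel Q := [rel x y | covered_in S x y || covered_in S y x].

Definition covered x y : bool := covered_in setT x y.
Definition hasse : rel Q := hasse_in setT.

(* The edges are those of the Hasse diagram of [Q], not of the subposet [S]. *)
Definition cc S : nat := #|components hasse S|.

(* The downset generated by [S]. *)
Definition downset S : {set Q} := [set x | [exists y in S, x <= y]].

Definition M_set : {set Q} := [set x | [forall y, covered y x ==> minimal y]].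

Definition M_acyclic : Prop := acyclic (hasse_in M_set).

Definition M_components : {set {set Q}} := components (hasse_in M_set) M_set.

Definition tree_downset_condition : Prop :=
  forall S, S \subset ~: M_set -> (1 <= #|S| <= #|M_components|)%N ->
  let Ts := [set T in M_components | T :&: downset S != set0] in
  forall Tj, Tj \in Ts ->
  let A := downset (S :|: \bigcup_(T in Ts | T != Tj) T) in
  cc A = 1 -> cc (A :&: M_set) = #|Ts|.

Definition tree_rel : rel Q :=
  [rel x y | (x == y) || [exists T in M_components, (x \in T) && (y \in T)]].

Definition tree_classes : {set {set Q}} :=
  equivalence_partition tree_rel [set: Q].

Definition tree_quotient : Type := {X : {set Q} | X \in tree_classes}.
HB.instance Definition _ := SubFinite.on tree_quotient.

(* This is a partial order whether or not [M_acyclic] holds, so the iterated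
   quotients are posets for every [k]. *)
Definition tree_le : rel tree_quotient :=
  [rel X Y : tree_quotient | [exists x in val X, exists y in val Y, x <= y]].

Lemma hasse_in_sym S : symmetric (hasse_in S).
Proof. by move=> x y; rewrite /hasse_in /= orbC. Qed.

Lemma M_connect_sym : connect_sym (induced (hasse_in M_set) M_set).
Proof. by apply: induced_connect_sym; apply: hasse_in_sym. Qed.

Lemma tree_relE x y : tree_rel x y =
  (x == y) || [&& x \in M_set, y \in M_set
                & connect (induced (hasse_in M_set) M_set) x y].
Proof. by rewrite /tree_rel /= same_componentE //; apply: hasse_in_sym. Qed.

Lemma tree_rel_equiv : equivalence_rel tree_rel.
Proof.
move=> x y z; split; first by rewrite /tree_rel /= eqxx.
rewrite !tree_relE => /orP[/eqP->//|/and3P[xM yM xy]].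
have same := same_connect M_connect_sym xy z; rewrite xM yM same.
have [<-|nxz] /= := eqVneq x z.
  by rewrite xM M_connect_sym xy orbT.
by have [<-|] //= := eqVneq y z; rewrite yM connect0.
Qed.

Lemma tree_rel_same x y z : tree_rel x y -> tree_rel x z = tree_rel y z.
Proof. exact: (tree_rel_equiv x y z).2. Qed.

Lemma tree_rel_refl x : tree_rel x x.
Proof. by rewrite /tree_rel /= eqxx. Qed.

Lemma tree_rel_sym : symmetric tree_rel.
Proof.
by move=> x y; apply/idP/idP => xy; rewrite -(tree_rel_same _ xy) tree_rel_refl.
Qed.

Lemma tree_classesP (X : tree_quotient) x :
  x \in val X -> val X = [set y | tree_rel x y].
Proof.
case: X => X /= /imsetP[z _ ->]; rewrite inE => /andP[_ zx].
by apply/setP => y; rewrite !inE (tree_rel_same _ zx).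
Qed.

Lemma tree_quotient_eq (X Y : tree_quotient) x y :
  x \in val X -> y \in val Y -> tree_rel x y -> X = Y.
Proof.
move=> xX yY xy; apply: val_inj; rewrite (tree_classesP xX) (tree_classesP yY).
by apply/setP => z; rewrite !inE; apply: tree_rel_same.
Qed.

Lemma tree_quotient_rel (X : tree_quotient) x y :
  x \in val X -> y \in val X -> tree_rel x y.
Proof. by move=> /tree_classesP->; rewrite inE. Qed.

Lemma ex_cover x y : x < y -> exists2 z, x <= z & covered z y.
Proof.
move=> xy; pose P := [pred z | x <= z < y].
have Px : P x by rewrite /= lexx xy.
case: (arg_maxnP (fun z => #|[set w | w <= z]|) Px) => z /andP[xz zy] zmax.
exists z => //; rewrite /covered /covered_in !inE zy /=.
apply/forallP => w; rewrite inE /=; apply/negP => /andP[zw wy].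
have := zmax w; rewrite /P /= wy (le_trans xz (ltW zw)) => /(_ isT).
apply/negP; rewrite -ltnNge; apply: proper_card; apply/properP; split.
  by apply/subsetP => v; rewrite !inE => /le_trans; apply; apply: ltW.
by exists w; rewrite inE ?lexx // (lt_geF zw).
Qed.

(* Two distinct comparable elements of [M_set] are joined by an edge. *)
Lemma M_set_le x y : y \in M_set -> x <= y -> tree_rel x y.
Proof.
move=> yM; rewrite le_eqVlt tree_relE => /orP[-> //|xy].
have [z xz zy] := ex_cover xy.
have zmin : minimal z by move: yM; rewrite inE => /forallP/(_ z); rewrite zy.
have xE : x = z.
  by move: xz; rewrite le_eqVlt => /orP[/eqP//|]; rewrite (negPf (forallP zmin x)).
have xM : x \in M_set.
  rewrite inE; apply/forallP => w; apply/implyP => /and4P[_ _ wx _].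
  by move: wx; rewrite xE (negPf (forallP zmin w)).
rewrite xM yM; apply/orP; right; apply: connect1.
rewrite /induced /hasse_in /= xM yM /covered_in xM yM xy /=; apply/orP; left.
apply/forallP => w; apply/implyP => _; move: zy; rewrite xE => /and4P[_ _ _].
by move=> /forallP/(_ w); rewrite inE.
Qed.

Fact tree_le_refl : reflexive tree_le.
Proof.
case=> X XP; have /imsetP[x _ XE] := XP.
have xX : x \in X by rewrite XE !inE tree_rel_refl.
by apply/existsP; exists x; rewrite xX; apply/existsP; exists x; rewrite xX /=.
Qed.

Lemma tree_leP (X Y : tree_quotient) :
  reflect (exists x y, [/\ x \in val X, y \in val Y & x <= y]) (tree_le X Y).
Proof.
apply: (iffP existsP) => [[x /andP[xX /existsP[y /andP[yY xy]]]]|[x [y [xX yY xy]]]].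
  by exists x, y.
by exists x; rewrite xX; apply/existsP; exists y; rewrite yY.
Qed.

(* Either [x' = y'], or both lie in [M_set], and then anything below [x'] is
   in the same class. *)
Lemma tree_class_le (X : tree_quotient) x y y' :
  y \in val X -> y' \in val X -> x <= y -> x \in val X \/ x <= y'.
Proof.
move=> yX y'X xy; have := tree_quotient_rel yX y'X.
rewrite tree_relE => /orP[/eqP<-|/and3P[yM _ _]]; [by right|left].
by rewrite (tree_classesP yX) inE tree_rel_sym M_set_le.
Qed.

Fact tree_le_trans : transitive tree_le.
Proof.
move=> Y X Z /tree_leP[x [y [xX yY xy]]] /tree_leP[y' [z [y'Y zZ yz]]].
apply/tree_leP; have [xY|xy'] := tree_class_le yY y'Y xy.
  rewrite (tree_quotient_eq xX xY _) ?(tree_quotient_rel xX xX) //.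
  by exists y', z.
by exists x, z; split=> //; apply: le_trans yz.
Qed.

Fact tree_le_anti : antisymmetric tree_le.
Proof.
move=> X Y /andP[/tree_leP[x [y [xX yY xy]]] /tree_leP[y' [x' [y'Y x'X yx]]]].
have [xY|xy'] := tree_class_le yY y'Y xy.
  by rewrite (tree_quotient_eq xX xY) // (tree_quotient_rel xX xX).
have [y'X|y'x] := tree_class_le x'X xX yx.
  by rewrite (tree_quotient_eq y'X y'Y) // (tree_quotient_rel y'Y y'Y).
have E : x = y' by apply: le_anti; rewrite xy' y'x.
by apply: (tree_quotient_eq xX y'Y); rewrite E (tree_quotient_rel y'Y y'Y).
Qed.

HB.instance Definition _ := Order.Le_isPOrder.Build d tree_quotient
  tree_le_refl tree_le_anti tree_le_trans.

End Posets.

(* P / ~^k *)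
Fixpoint iter_tree_quotient (d : Order.disp_t) (k : nat) (P : finPOrderType d) :
    finPOrderType d :=
  if k is k'.+1 then tree_quotient (iter_tree_quotient k' P) else P.

(* Main.v *)
From HB Require Import structures.
Require Import Defs.
From mathcomp Require Import all_boot all_order all_algebra.
From mathcomp Require Import reals.

Set Implicit Arguments.
Unset Strict Implicit.
Unset Printing Implicit Defensive.

Import Order.TTheory GRing.Theory Num.Theory.

(* Both sides are equivalent to the condition [intersecting]: any two connected
   downsets meet in a connected (or empty) set.

   The rays of the braid cone are spanned by the indicators of the complements
   of the nonempty connected downsets [D] avoiding the top, so the cone is
   Gorenstein iff some integer weight [f] on the poset sums to 1 over every such
   [D].  If [A] and [B] overlap, then f(A :|: B) + f(A :&: B) = f(A) + f(B)
   forces f(A :&: B), the number of components of [A :&: B], to be 1.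
   Conversely, the weight with sum 1 on every principal downset has sum 1 on
   every connected one, by adding principal downsets one at a time.

   On the other side, a poset is [intersecting] iff its M-set is acyclic, the
   tree downset condition holds and its tree quotient is [intersecting]; the
   quotient is shorter by one, and antichains are [intersecting].  The main
   point is that the tree downset condition makes [T :&: A] connected for every
   connected downset [A] and component [T] of the M-set: a detour in [A] between
   two components of [T :&: A] can be chosen to pass through each other
   component of the M-set at most once, so it is produced by a set [S] obeying
   the bound on #|S|. *)

(** * Induced subgraphs *)

Section InducedGraphs.
Variable T : finType.
Implicit Types (e : rel T) (S : {set T}).

Lemma connect_induced_in e S x y :
  connect (induced e S) x y -> (x \in S) = (y \in S).
Proof.
case/connectP=> p + ->{y}; elim: p x => [|z p IHp] x //=.
by case/andP=> /and3P[-> + _] /IHp => ->.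
Qed.

Lemma connect_homo (U : finType) e (e' : rel U) (h : T -> U) x y :
  (forall x y, e x y -> connect e' (h x) (h y)) ->
  connect e x y -> connect e' (h x) (h y).
Proof.
move=> eh /connectP[p + ->{y}]; elim: p x => [|z p IHp] x //=.
by case/andP=> /eh xz /IHp; apply: connect_trans.
Qed.

Lemma connect_induced_sub e e' S x y :
  (forall x y, x \in S -> y \in S -> e x y -> connect (induced e' S) x y) ->
  connect (induced e S) x y -> connect (induced e' S) x y.
Proof.
move=> ee'; apply: (connect_homo (h := id)) => u v /and3P[uS vS].
exact: ee'.
Qed.

Lemma connect_inducedS e S S' x y : S \subset S' ->
  connect (induced e S) x y -> connect (induced e S') x y.
Proof.
move=> /subsetP SS'; apply: connect_sub => {x y} x y /and3P[xS yS xy].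
by apply: connect1; rewrite /induced /= !SS'.
Qed.

Lemma componentP e S U x : symmetric e -> U \in components e S -> x \in U ->
  x \in S /\ U = [set y | (y \in S) && connect (induced e S) x y].
Proof.
move=> se /imsetP[z zS ->]; rewrite inE => /andP[xS zx]; split=> //.
have same := same_connect (induced_connect_sym S se) zx.
by apply/setP => y; rewrite !inE same.
Qed.

Lemma component_nonempty e S U : U \in components e S -> exists x, x \in U.
Proof. by case/imsetP=> x xS ->; exists x; rewrite inE xS connect0. Qed.

(** Otherwise a simple path from [a] to [b] avoiding [x] closes up through [x] to a cycle with at
    least three vertices. *)
Lemma acyclic_neighbors e x a b : symmetric e -> acyclic e ->
  e x a -> e x b -> x != a -> x != b ->
  connect (induced e [set~ x]) a b -> a = b.
Proof.
move=> se ace xa xb nxa nxb /connectP[p pp bE].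
move: pp bE xb nxb => /shortenP[p' pp' up' _ ->] {p b}.
move: p' pp' up' => p pp up xb nxb.
case: (eqVneq a (last a p)) => // nab; case: (ace (x :: a :: p)).
  by case: p nab {pp up xb nxb} => //=; rewrite eqxx.
have xp : x \notin a :: p.
  rewrite inE (negPf nxa) /=; apply/negP => xp.
  have := path_connect pp (mem_behead (s := a :: p) xp).
  by move/connect_induced_in; rewrite !inE eqxx eq_sym nxa.
rewrite /ucycle cons_uniq xp up andbT /= rcons_path xa se xb andbT /=.
by rewrite andbT; apply: sub_path pp => u v /and3P[].
Qed.

(** Simple paths in a forest are unique, so the paths inside [S] and [S'] coincide. By induction
    along the first one: both tails avoid [x] and end at the same vertex, so the first steps agree
    by [acyclic_neighbors]. *)
Lemma acyclic_connectI e S S' x y : symmetric e -> acyclic e ->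
  connect (induced e S) x y -> connect (induced e S') x y ->
  connect (induced e (S :&: S')) x y.
Proof.
move=> se ace /connectP[p pp ->] {y} /connectP[q].
case/shortenP: pp => p' pp up _ {p}; elim: p' x q pp up => [|a p IHp] x q /=.
  by rewrite connect0.
case/andP=> /and3P[xS aS xa] pp /andP[xp up].
case/shortenP => -[|b q'] /=.
  by move=> _ _ _ xE; rewrite -{1}xE mem_last in xp.
case/andP=> /and3P[xS' bS' xb] qq /andP[xq uq] _ lastE.
(* The tail of a simple path from [x] connects its ends without returning to [x]. *)
have nx (z : T) r W : path (induced e W) z r -> x \notin z :: r ->
    connect (induced e [set~ x]) z (last z r).
  elim: r z => [|w r IHr] z /=; first by rewrite connect0.
  case/andP=> /and3P[_ _ zw] /IHr{}IHr; rewrite inE negb_or => /andP[xz xr].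
  apply: connect_trans (IHr xr); apply: connect1; rewrite /induced /= !inE zw.
  by rewrite eq_sym xz; move: xr; rewrite inE negb_or eq_sym => /andP[->].
have ab : a = b.
  apply: (acyclic_neighbors se ace xa xb).
  - by move: xp; rewrite inE negb_or => /andP[].
  - by move: xq; rewrite inE negb_or => /andP[].
  apply: connect_trans (nx _ _ _ pp xp) _; rewrite lastE.
  by rewrite induced_connect_sym //; apply: nx qq xq.
rewrite -{}ab in bS' qq lastE.
apply: connect_trans (IHp a q' pp up qq lastE).
by apply: connect1; rewrite /induced /= !inE xS xS' aS bS'.
Qed.

End InducedGraphs.

(** * Connected downsets *)

Section Downsets.
Local Open Scope order_scope.
Variables (d : Order.disp_t) (Q : finPOrderType d).
Implicit Types (x y z : Q) (A B D S : {set Q}).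

Definition is_downset D := forall x y, x <= y -> y \in D -> x \in D.

(* Connectivity is measured in the comparability graph; on downsets it agrees
   with the Hasse diagram, see [link_hasse]. *)
Definition link D : rel Q := connect (induced >=<%O D).

(** The empty set counts as linked, so disjoint downsets do not violate [intersecting]. *)
Definition linked D := {in D &, forall x y, link D x y}.

Definition intersecting : Prop := forall A B, is_downset A -> is_downset B ->
  linked A -> linked B -> linked (A :&: B).

Lemma comparable_symmetric : symmetric (>=<%O : rel Q).
Proof. by move=> x y; rewrite comparable_sym. Qed.

Lemma link_sym D : symmetric (link D).
Proof. exact: (induced_connect_sym _ comparable_symmetric). Qed.

Lemma link_trans D : transitive (link D).
Proof. exact: connect_trans. Qed.

Lemma link_refl D x : link D x x.
Proof. exact: connect0. Qed.

Lemma link_in D x y : link D x y -> (x \in D) = (y \in D).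
Proof. exact: connect_induced_in. Qed.

Lemma linkS D D' x y : D \subset D' -> link D x y -> link D' x y.
Proof. exact: connect_inducedS. Qed.

Lemma link_le D x y : is_downset D -> y \in D -> x <= y -> link D x y.
Proof.
move=> Dd yD xy; apply: connect1.
by rewrite /induced /= yD (Dd _ _ xy yD) /Order.comparable xy.
Qed.

Lemma downset_setI A B : is_downset A -> is_downset B -> is_downset (A :&: B).
Proof.
move=> Ad Bd x y xy; rewrite !inE => /andP[yA yB].
by rewrite (Ad _ _ xy) // (Bd _ _ xy).
Qed.

Lemma downset_setU A B : is_downset A -> is_downset B -> is_downset (A :|: B).
Proof.
move=> Ad Bd x y xy; rewrite !inE => /orP[/(Ad _ _ xy)->//|/(Bd _ _ xy)->].
by rewrite orbT.
Qed.

Lemma is_downset_downset S : is_downset (downset S).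
Proof.
move=> x y xy; rewrite !inE => /existsP[z /andP[zS yz]].
by apply/existsP; exists z; rewrite zS (le_trans xy).
Qed.

Lemma downsetP S x : reflect (exists2 y, y \in S & x <= y) (x \in downset S).
Proof. by rewrite inE; apply: exists_inP. Qed.

Lemma sub_downset S : S \subset downset S.
Proof. by apply/subsetP => x xS; apply/downsetP; exists x. Qed.

Lemma downset_min S D : is_downset D -> S \subset D -> downset S \subset D.
Proof.
move=> Dd /subsetP SD; apply/subsetP => x /downsetP[y /SD yD xy].
exact: Dd yD.
Qed.

Lemma linked_downset1 x : linked (downset [set x]).
Proof.
have Dd := @is_downset_downset [set x].
have xD : x \in downset [set x] by apply/downsetP; exists x; rewrite ?set11.
move=> y z /downsetP[_ /set1P-> yx] /downsetP[_ /set1P-> zx].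
by apply: link_trans (link_le Dd xD yx) _; rewrite link_sym link_le.
Qed.

Lemma linkedU A B x : x \in A -> x \in B -> linked A -> linked B ->
  linked (A :|: B).
Proof.
move=> xA xB Al Bl; have lx y : y \in A :|: B -> link (A :|: B) x y.
  case/setUP=> [yA|yB].
    by apply: linkS (Al _ _ xA yA); apply: subsetUl.
  by apply: linkS (Bl _ _ xB yB); apply: subsetUr.
by move=> y z yU zU; apply: (link_trans (y := x)); rewrite ?lx // link_sym lx.
Qed.

(** A path inside [A] from [x] to [y] has a first step that leaves [S]. *)
Lemma linked_cross A S x y : linked A -> S \subset A -> x \in S ->
  y \in A -> y \notin S -> exists u v, [/\ u \in S, v \in A, v \notin S & u >=< v].
Proof.
move=> Al SA xS yA yS; have := Al _ _ (subsetP SA _ xS) yA.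
case/connectP=> p + E; rewrite {y}E in yA yS *.
elim: p x xS yA yS => [|z p IHp] x xS /=; first by rewrite xS.
move=> yA yS /andP[/and3P[_ zA xz]].
have [zS|zS] := boolP (z \in S); first exact: IHp.
by exists x, z.
Qed.

Lemma le_hasse_connect D x y : is_downset D -> y \in D -> x <= y ->
  connect (induced (@hasse d Q) D) x y.
Proof.
move=> Dd; have [n] := ubnP #|[set z | z <= y]|.
elim: n x y => // n IHn x y ny yD xy.
move: xy; rewrite le_eqVlt => /orP[/eqP->|xy]; first exact: connect0.
have [z xz zy] := ex_cover xy; have /and4P[_ _ zlty _] := zy.
apply: connect_trans (IHn x z _ (Dd _ _ (ltW zlty) yD) xz) _.
  rewrite ltnS in ny; apply: leq_trans ny.
  apply: proper_card; apply/properP; split; last first.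
    by exists y; rewrite inE ?lexx // (lt_geF zlty).
  by apply/subsetP => w; rewrite !inE => /le_trans->//; apply: ltW.
apply: connect1; rewrite /induced /= (Dd _ _ (ltW zlty)) // yD /=.
by rewrite /hasse/hasse_in/= -/(covered z y) zy.
Qed.

Lemma link_hasse D : is_downset D -> link D =2 connect (induced (@hasse d Q) D).
Proof.
move=> Dd x y; apply/idP/idP; apply: connect_induced_sub => u v uD vD.
  move=> /orP[]; first exact: le_hasse_connect.
  rewrite induced_connect_sym; first exact: le_hasse_connect.
  exact: hasse_in_sym.
move=> uv; apply: connect1; rewrite /induced /= uD vD /=.
by case/orP: uv => /and4P[_ _ /ltW uv _]; rewrite /Order.comparable uv ?orbT.
Qed.

Lemma cc1P D : is_downset D -> reflect (D != set0 /\ linked D) (cc D == 1%N).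
Proof.
move=> Dd; have hs := @hasse_in_sym _ Q [set: Q]; apply: (iffP cards1P).
  case=> U UE; have UD : U \in components (@hasse d Q) D by rewrite UE set11.
  have [x xU] := component_nonempty UD.
  have [xD _] := componentP hs UD xU.
  split=> [|y z yD zD]; first by apply/set0Pn; exists x.
  rewrite link_hasse //.
  have inU w : w \in D -> w \in U.
    move=> wD; pose C := [set v in D | connect (induced (@hasse d Q) D) w v].
    have : C \in components (@hasse d Q) D by apply/imsetP; exists w.
    by rewrite UE => /set1P<-; rewrite inE wD connect0.
  have [_ yUE] := componentP hs UD (inU y yD).
  by have := inU z zD; rewrite yUE inE => /andP[].
case=> /set0Pn[x xD] Dl; exists D; apply/setP => U; rewrite inE.
apply/idP/eqP => [UD|->].
  have [y yU] := component_nonempty UD; have [yD ->] := componentP hs UD yU.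
  apply/setP => z; rewrite inE -link_hasse //; case zD: (z \in D) => //=.
  exact: Dl.
apply/imsetP; exists x => //; apply/setP => z; rewrite inE -link_hasse //.
by case zD: (z \in D) => //=; rewrite Dl.
Qed.

End Downsets.

(** * The components of the M-set *)

Section TreeComponents.
Local Open Scope order_scope.
Variables (d : Order.disp_t) (Q : finPOrderType d).
Implicit Types (x y z : Q) (A B D S T : {set Q}).
Let M := M_set Q.

(** Some [z] above [x] is covered by [y], hence minimal, which forces [z = x]. Thus [M] contains no
    chain of three elements. *)
Lemma M_set_lt x y : y \in M -> x < y -> hasse_in M x y /\ minimal x.
Proof.
move=> yM xy; have xM : x \in M.
  have := M_set_le yM (ltW xy); rewrite tree_relE (lt_eqF xy) /=.
  by case/and3P.
have zmin z : x <= z -> covered z y -> z = x /\ minimal x.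
  move=> xz zy; have zm : minimal z.
    by move: yM; rewrite inE => /forallP/(_ z); rewrite zy.
  move: xz; rewrite le_eqVlt => /orP[/eqP->|]; first by split.
  by rewrite (negPf (forallP zm x)).
have [z xz zy] := ex_cover xy; have [zx xm] := zmin z xz zy.
split=> //; rewrite /hasse_in /= /covered_in xM yM xy /=; apply/orP; left.
apply/forallP => w; apply/implyP => _; apply/negP => /andP[xw wy].
have [v wv vy] := ex_cover wy; have [vx _] := zmin v (le_trans (ltW xw) wv) vy.
by move: wv; rewrite vx (lt_geF xw).
Qed.

Lemma M_set_downset : is_downset M.
Proof.
move=> x y xy yM; have := M_set_le yM xy.
by rewrite tree_relE => /orP[/eqP->//|/and3P[]].
Qed.

(** In [M] two distinct comparable elements already form an edge of the Hasse diagram, so the two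
    graphs agree on every subset of [M]. *)
Lemma link_hasse_M D : D \subset M -> link D =2 connect (induced (hasse_in M) D).
Proof.
move=> DM x y; apply/idP/idP; apply: connect_induced_sub => u v uD vD.
  have [->|nuv] := eqVneq u v; first by rewrite connect0.
  move=> uv; apply: connect1; rewrite /induced /= uD vD /=.
  move: uv; rewrite /Order.comparable !le_eqVlt (negPf nuv) eq_sym (negPf nuv).
  case/orP => uv; first by have [] := M_set_lt (subsetP DM _ vD) uv.
  by have [] := M_set_lt (subsetP DM _ uD) uv; rewrite hasse_in_sym.
move=> uv; apply: connect1; rewrite /induced /= uD vD /=.
by case/orP: uv => /and4P[_ _ /ltW uv _]; rewrite /Order.comparable uv ?orbT.
Qed.

Definition M_class x := [set y in M | link M x y].

Lemma M_classP T x : T \in M_components Q -> x \in T -> x \in M /\ T = M_class x.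
Proof.
move=> TM xT; have [xM ->] := componentP (hasse_in_sym M) TM xT.
by split=> //; apply/setP => y; rewrite !inE -/M -link_hasse_M.
Qed.

Lemma M_class_in x : x \in M -> M_class x \in M_components Q.
Proof.
move=> xM; apply/imsetP; exists x => //; apply/setP => y.
by rewrite !inE -/M -link_hasse_M.
Qed.

Lemma mem_M_class x : x \in M -> x \in M_class x.
Proof. by move=> xM; rewrite inE xM link_refl. Qed.

Lemma M_component_sub T : T \in M_components Q -> T \subset M.
Proof. by move=> TM; apply/subsetP => x /(M_classP TM)[]. Qed.

Lemma M_component_eq T T' x : T \in M_components Q -> T' \in M_components Q ->
  x \in T -> x \in T' -> T = T'.
Proof. by move=> /M_classP TM /M_classP T'M /TM[_ ->] /T'M[_ ->]. Qed.

Lemma mem_M_component T x y : T \in M_components Q -> x \in T ->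
  link M x y -> y \in T.
Proof.
by move=> TM xT xy; have [xM ->] := M_classP TM xT; rewrite inE xy -(link_in xy) xM.
Qed.

Lemma M_component_le T x y : T \in M_components Q -> x \in T -> y \in M ->
  x >=< y -> y \in T.
Proof.
move=> TM xT yM xy; apply: (mem_M_component TM xT); apply: connect1.
by rewrite /induced /= -/M yM xy (subsetP (M_component_sub TM) _ xT).
Qed.

Lemma M_component_downset T : T \in M_components Q -> is_downset T.
Proof.
move=> TM x y xy yT; apply: (M_component_le TM yT).
  exact: M_set_downset xy (subsetP (M_component_sub TM) _ yT).
by rewrite /Order.comparable xy orbT.
Qed.

Lemma link_component T x y : T \in M_components Q -> x \in T ->
  link M x y -> link T x y.
Proof.
move=> TM + /connectP[p + ->{y}]; elim: p x => [|z p IHp] x xT /=.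
  by rewrite link_refl.
case/andP=> /and3P[_ zM xz] pp; have zT := M_component_le TM xT zM xz.
apply: link_trans (IHp z zT pp); apply: connect1.
by rewrite /induced /= xT zT xz.
Qed.

Lemma M_component_linked T : T \in M_components Q -> linked T.
Proof.
move=> TM x y xT yT; apply: link_component => //.
by have [xM TE] := M_classP TM xT; move: yT; rewrite TE inE => /andP[].
Qed.

(** [phi] sends a component of [D] to the component of [M] containing it. Its image is [Ts], so
    equality of the cardinals means that [phi] is injective: no [T] contains two components of
    [D]. *)
Lemma cc_components D : is_downset D -> D \subset M ->
  cc D = #|[set T in M_components Q | T :&: D != set0]| <->
  {in M_components Q, forall T, linked (T :&: D)}.
Proof.
move=> Dd DM; set Ts := [set T in _ | _].
pose phi (U : {set Q}) := [set y in M | [exists x in U, link M x y]].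
pose C x := [set y in D | link D x y].
have CE U x : U \in components (@hasse d Q) D -> x \in U -> x \in D /\ U = C x.
  move=> UD xU; have [xD ->] := componentP (hasse_in_sym [set: Q]) UD xU.
  by split=> //; apply/setP => y; rewrite !inE -link_hasse.
have Cin x : x \in D -> C x \in components (@hasse d Q) D.
  move=> xD; apply/imsetP; exists x => //; apply/setP => y.
  by rewrite !inE -link_hasse.
have phiC x : x \in D -> phi (C x) = M_class x.
  move=> xD; apply/setP => y; rewrite inE [in RHS]inE; case: (y \in M) => //=.
  apply/exists_inP/idP => [[z]|xy].
    by rewrite inE => /andP[zD /(linkS DM) xz]; apply: link_trans xz.
  by exists x; rewrite // inE xD link_refl.
have phiTs : phi @: components (@hasse d Q) D = Ts.
  apply/setP => T; apply/imsetP/idP => [[U UD ->]|].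
    have [x xU] := component_nonempty UD; have [xD ->] := CE U x UD xU.
    rewrite phiC // inE M_class_in ?(subsetP DM) //=; apply/set0Pn; exists x.
    by rewrite inE xD mem_M_class ?(subsetP DM).
  rewrite inE => /andP[TM /set0Pn[x /setIP[xT xD]]].
  by exists (C x); rewrite ?Cin // phiC //; have [] := M_classP TM xT.
rewrite -phiTs /cc; split=> [/esym/eqP/imset_injP inj T TM x y|Tl].
  move=> /setIP[xT xD] /setIP[yT yD].
  have : C x = C y.
    apply: inj; rewrite ?Cin // !phiC //.
    by have [_ <-] := M_classP TM xT; have [_ <-] := M_classP TM yT.
  move/setP/(_ y); rewrite !inE yD link_refl /= => xy.
  have yTD : y \in T :&: D by rewrite inE yT.
  case/connectP: xy yTD => p + ->; elim: p x xT xD => [|z p IHp] x xT xD /=.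
    by rewrite link_refl.
  case/andP=> /and3P[_ zD xz] pp yTD.
  have zT := M_component_le TM xT (subsetP DM _ zD) xz.
  apply: link_trans (IHp z zT zD pp yTD); apply: connect1.
  by rewrite /induced /= !inE xT xD zT zD.
apply/esym/eqP/imset_injP => U V UD VD.
have [x xU] := component_nonempty UD; have [xD UE] := CE U x UD xU.
have [y yV] := component_nonempty VD; have [yD VE] := CE V y VD yV.
rewrite UE VE !phiC // => xy; have xM := subsetP DM _ xD.
have lxy : link D x y.
  apply: linkS (Tl (M_class x) (M_class_in xM) x y _ _); rewrite ?subsetIr //.
    by rewrite inE mem_M_class.
  by rewrite inE xy mem_M_class ?(subsetP DM).
apply/setP => z; rewrite !inE; case: (z \in D) => //=.
by apply/idP/idP; apply: link_trans; rewrite // link_sym.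
Qed.

End TreeComponents.

(** * The tree downset condition *)

Section TreeDownsetCondition.
Local Open Scope order_scope.
Variables (d : Order.disp_t) (Q : finPOrderType d).
Implicit Types (x y z : Q) (A B D S T : {set Q}).
Let M := M_set Q.

(** Let [x] be a non-minimal vertex of a cycle, with neighbors [a] and [b]. The rest of the cycle
    generates a connected downset [B] without [x]. Its intersection with the principal downset of
    [x] contains [a] and [b], but consists of minimal elements, so it is not connected. *)
Lemma intersecting_M_acyclic : intersecting Q -> M_acyclic Q.
Proof.
move=> QI c c2 uc; pose e := hasse_in M.
have eM u v : e u v -> [/\ u \in M, v \in M & u < v \/ v < u].
  by case/orP=> /and4P[-> -> uv _]; split=> //; [left|right].
have [x xc xm] : exists2 x, x \in c & ~~ minimal x.
  move: uc; case: c c2 => // u [|v c] // _ /andP[/= /andP[/eM[uM vM uv] _] _].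
  case: uv => uv; [exists v|exists u]; rewrite ?inE ?eqxx ?orbT //.
    by apply/forallPn; exists u; rewrite uv.
  by apply/forallPn; exists v; rewrite uv.
(* Rotate the cycle to start at [x]; what remains is a path from [a] to [b]. *)
case/rot_to: xc => i c' cE; move: uc c2; rewrite -(rot_ucycle i) -(size_rot i) {}cE.
case: c' => {c} // a c /andP[/= /andP[exa pc] /andP[xac uc]] cn.
rewrite rcons_path in pc; case/andP: pc => pc ebx; set b := last a c in ebx.
have xlt z : e x z -> z < x.
  case/eM=> _ zM [] // /(M_set_lt zM)[_ xmin].
  by rewrite xmin in xm.
have xM : x \in M by have [] := eM _ _ exa.
have nab : a != b.
  rewrite /b; case: (c) cn uc => // z p _ /= /andP[anp _].
  by apply: contra anp => /eqP->; rewrite mem_last.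
pose B := downset [set z in a :: c].
have Bd : is_downset B by apply: is_downset_downset.
have cB z : z \in a :: c -> z \in B.
  by move=> zc; apply: (subsetP (sub_downset _)); rewrite inE.
have cM z : z \in a :: c -> z \in M.
  have [aM _ _] := eM _ _ (etrans (hasse_in_sym _ _ _) exa).
  rewrite inE => /orP[/eqP->//|zc].
  have := path_connect pc (mem_behead (s := a :: c) zc).
  rewrite -(_ : connect (induced e M) =2 connect e).
    by move/connect_induced_in <-.
  by apply: eq_connect => u v; apply/and3P/idP=> [[]//|/[dup]/eM[]].
(* An element strictly below a vertex of the cycle is minimal, and [x] is not. *)
have xB : x \notin B.
  apply/negP => /downsetP[z]; rewrite inE => zc.
  rewrite le_eqVlt => /orP[/eqP xz|xz]; first by rewrite xz zc in xac.
  by have [_ xmin] := M_set_lt (cM z zc) xz; rewrite xmin in xm.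
have lB z : z \in a :: c -> link B a z.
  move=> zc; have pB : path (induced e B) a c.
    apply: (sub_in_path (P := mem B) _ _ pc) => [u v uB vB uv|].
      by rewrite /induced /= [_ \in _]uB [_ \in _]vB.
    by apply/allP => w /cB.
  have := path_connect pB zc; apply: connect_induced_sub => u v uB vB.
  case/eM=> _ _ uv; apply: connect1; rewrite /induced /= uB vB /Order.comparable.
  by case: uv => /ltW->; rewrite ?orbT.
have Bl : linked B.
  have la z : z \in B -> link B a z.
    case/downsetP=> w; rewrite inE => wc zw; apply: link_trans (lB w wc) _.
    by rewrite link_sym; apply: link_le zw; rewrite ?cB.
  by move=> u v uB vB; apply: (link_trans (y := a)); rewrite ?la // link_sym la.
have ABl := QI _ _ (@is_downset_downset _ _ [set x]) Bd (@linked_downset1 _ _ x) Bl.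
have inAB z : z \in a :: c -> e x z -> z \in downset [set x] :&: B.
  move=> zc /xlt zx; rewrite inE cB // andbT; apply/downsetP.
  by exists x; rewrite ?set11 // ltW.
have bc : b \in a :: c by apply: mem_last.
have [] := linked_cross (x := a) (y := b) (S := [set a]) ABl.
- by rewrite sub1set inAB ?mem_head.
- exact: set11.
- by rewrite inAB // /e hasse_in_sym.
- by rewrite inE eq_sym.
move=> _ [v [/set1P-> /setIP[/downsetP[_ /set1P-> vx] vB] va av]].
move: vx; rewrite le_eqVlt => /orP[/eqP vx|vx].
  by rewrite vx (negPf xB) in vB.
have [_ vmin] := M_set_lt xM vx; have [_ amin] := M_set_lt xM (xlt _ exa).
move: av va; rewrite inE /Order.comparable !le_eqVlt.
rewrite (negPf (forallP vmin a)) (negPf (forallP amin v)) !orbF eq_sym orbb.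
by move->.
Qed.

Section Generated.
Variable S : {set Q}.
(** [Ts] and [A] are the objects of [tree_downset_condition], with [Tj] the component left out of
    the generators. *)
Let Ts := [set T in M_components Q | T :&: downset S != set0].
Variable Tj : {set Q}.
Let A := downset (S :|: \bigcup_(T in Ts | T != Tj) T).

Lemma generated_downset_le x :
  x \in A -> x \in downset S \/ exists T, [/\ T \in Ts, T != Tj & x \in T].
Proof.
case/downsetP=> y /setUP[yS xy|]; first by left; apply/downsetP; exists y.
case/bigcupP=> T /andP[TTs nT] yT xy; right; exists T; split=> //.
by move: TTs; rewrite inE => /andP[TM _]; apply: (M_component_downset TM) xy yT.
Qed.

Lemma generated_downset_S : downset S \subset A.
Proof.
apply: downset_min; first exact: is_downset_downset.
by apply: subset_trans (sub_downset _); apply: subsetUl.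
Qed.

Lemma generated_downset_T T : T \in Ts -> T != Tj -> T \subset A.
Proof.
move=> TTs nT; apply: subset_trans (sub_downset _).
by apply: subset_trans (subsetUr _ _); apply: bigcup_sup; rewrite TTs.
Qed.

(** Adding whole components that already meet [downset S] brings in no further component. *)
Lemma generated_downset_components :
  [set T in M_components Q | T :&: (A :&: M) != set0] = Ts.
Proof.
apply/setP => T; rewrite inE; apply/idP/idP.
  case/andP=> TM /set0Pn[x /setIP[xT /setIP[xA xM]]].
  case: (generated_downset_le xA) => [xS|[T' [T'Ts _ xT']]].
    by rewrite inE TM; apply/set0Pn; exists x; rewrite inE xT.
  move: (T'Ts); rewrite inE => /andP[T'M _].
  by rewrite (M_component_eq TM T'M xT xT').
rewrite inE => /andP[TM /set0Pn[x /setIP[xT xS]]]; rewrite TM; apply/set0Pn.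
exists x; rewrite !in_setI xT (subsetP generated_downset_S _ xS).
by rewrite (subsetP (M_component_sub TM)).
Qed.

(** Turns the numerical conclusion of the tree downset condition into connectedness of every
    [T :&: A]. *)
Lemma generated_downset_cc :
  cc (A :&: M) = #|Ts| <-> {in M_components Q, forall T, linked (T :&: A)}.
Proof.
rewrite -generated_downset_components cc_components ?subsetIr //; last first.
  by apply: downset_setI; [apply: is_downset_downset|apply: M_set_downset].
have E T : T \in M_components Q -> T :&: (A :&: M) = T :&: A.
  by move=> TM; rewrite setICA [T :&: M](setIidPl (M_component_sub TM)) setIC.
by split=> H T TM; have := H T TM; rewrite E.
Qed.

End Generated.

Lemma intersecting_tree_downset_condition :
  intersecting Q -> tree_downset_condition Q.
Proof.
move=> QI S SM Sk Ts Tj TjTs A ccA; apply/generated_downset_cc => T TM.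
have Ad : is_downset A by apply: is_downset_downset.
have [_ Al] := cc1P Ad (introT eqP ccA).
(* A component of [M] is itself a connected downset. *)
by apply: QI => //; [apply: M_component_downset|apply: M_component_linked].
Qed.

(** An element below [z] with the fewest elements beneath it is minimal, and minimal elements cover
    nothing. *)
Lemma exists_M_le z : exists2 m, m \in M & m <= z.
Proof.
have [m mz mmin] :=
  arg_minnP (P := fun w => w <= z) (fun w => #|[set v | v <= w]|) (lexx z).
exists m => //; rewrite inE; apply/forallP => y; apply/implyP => /and4P[_ _ ym _].
have := mmin y (le_trans (ltW ym) mz); rewrite leqNgt => /negP[].
apply: proper_card; apply/properP; split; last first.
  by exists m; rewrite inE ?lexx // (lt_geF ym).
by apply/subsetP => w; rewrite !inE => /le_trans->//; apply: ltW.
Qed.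

End TreeDownsetCondition.

(** * Connectedness of [T :&: A] from the tree downset condition *)

Section LinkedComponents.
Local Open Scope order_scope.
Variables (d : Order.disp_t) (Q : finPOrderType d).
Implicit Types (x y z : Q) (B D S : {set Q}).
Let M := M_set Q.
Hypothesis tdc : tree_downset_condition Q.
Variables (A T : {set Q}).
Hypotheses (Ad : is_downset A) (Al : linked A) (TM : T \in M_components Q).

(* The components of [N] are those of [T :&: A] and the components of [M] other
   than [T]; each is represented by its root. *)
Let N := (T :&: A) :|: (M :\: T).
Let rt : Q -> Q := fingraph.root (induced >=<%O N).
Let over (s a : Q) := [exists m in M, (m <= s) && (rt m == a)].
(** A graph on the roots whose edges are witnessed by elements of [A] outside [M]. In [share] these
    witnesses become the vertices; consecutive witnesses along a [meet] path are adjacent there as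
    long as the path avoids [T]. *)
Let meet a b := [exists s in A :\: M, over s a && over s b].
Let share s s' := [&& s \in A :\: M, s' \in A :\: M &
  [exists T' in M_components Q, [&& T' != T, [exists m in T', m <= s]
                                 & [exists m in T', m <= s']]]].

Let N_sub : N \subset M.
Proof.
rewrite subUset subsetDl andbT; apply: subset_trans (M_component_sub TM).
exact: subsetIl.
Qed.

Let AM_N : A :&: M \subset N.
Proof.
apply/subsetP => x; rewrite !in_setU !in_setI in_setD => /andP[-> ->].
by rewrite !andbT orbN.
Qed.

Let N_downset : is_downset N.
Proof.
move=> x y xy /setUP[/setIP[yT yA]|/setDP[yM yT]]; rewrite !in_setU in_setI in_setD.
  by rewrite (M_component_downset TM xy yT) (Ad xy yA).
rewrite (M_set_downset xy yM) andbT; apply/orP; right; apply: contra yT => xT.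
by apply: (M_component_le TM xT yM); rewrite /Order.comparable xy.
Qed.

Let N_M x y : link N x y -> link M x y.
Proof. exact: linkS N_sub. Qed.

Let N_T x y : x \in T -> link N x y -> link (T :&: A) x y.
Proof.
move=> + /connectP[p + ->{y}]; elim: p x => [|z p IHp] x xT /=.
  by rewrite link_refl.
case/andP=> /and3P[xN zN xz] pp.
have zT := M_component_le TM xT (subsetP N_sub _ zN) xz.
have inA w : w \in T -> w \in N -> w \in A.
  by move=> wT /setUP[/setIP[]|/setDP[_]] //; rewrite wT.
apply: link_trans (IHp z zT pp); apply: connect1.
by rewrite /induced /= !in_setI xT zT !inA.
Qed.

Let rtP x y : reflect (link N x y) (rt x == rt y).
Proof.
rewrite root_connect; first exact: idP.
exact: (induced_connect_sym _ (@comparable_symmetric _ Q)).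
Qed.

Let rt_link x : link N x (rt x).
Proof. exact: connect_root. Qed.

Let rt_rt x : rt (rt x) = rt x.
Proof. by apply/eqP/rtP; rewrite link_sym. Qed.

Let rt_T x : (rt x \in T) = (x \in T).
Proof.
have xr := N_M (rt_link x); apply/idP/idP => H.
  by apply: (mem_M_component TM H); rewrite link_sym.
exact: (mem_M_component TM H).
Qed.

(** If [a] is in [M], it joins [m] and [m'] within [N], so the roots agree; otherwise [a] witnesses
    an edge of [meet]. *)
Let meet_under a m m' : a \in A -> m \in M -> m' \in M -> m <= a -> m' <= a ->
  connect meet (rt m) (rt m').
Proof.
move=> aA mM m'M ma m'a; have [aM|aM] := boolP (a \in M).
  suff /rtP/eqP-> : link N m m' by apply: connect0.
  have aN : a \in N by apply: (subsetP AM_N); rewrite in_setI aA.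
  by apply: link_trans (link_le N_downset aN ma) _; rewrite link_sym link_le.
apply: connect1; apply/exists_inP; exists a; first by rewrite in_setD aM.
by apply/andP; split; apply/exists_inP; [exists m|exists m']; rewrite // eqxx andbT.
Qed.

(** Follow a path from [x] to [y] in [A], carrying an element of [M] below the current vertex. A
    step up keeps it; a step down replaces it by one below the new vertex, and [meet_under] compares
    the two. *)
Let meet_connect x y m m' : x \in A -> y \in A -> m \in M -> m' \in M ->
  m <= x -> m' <= y -> connect meet (rt m) (rt m').
Proof.
move=> xA yA mM m'M mx m'y; case/connectP: (Al xA yA) => p pp yE.
elim: p x m xA mM mx pp yE => [|z p IHp] x m xA mM mx /=.
  by move=> _ yx; apply: (meet_under xA) => //; rewrite -yx.
case/andP=> /and3P[_ zA xz] pp yE; case/orP: xz => [xz|zx].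
  exact: (IHp z m zA mM (le_trans mx xz)).
have [w wM wz] := exists_M_le z.
apply: connect_trans (IHp z w zA wM wz pp yE).
exact: (meet_under xA mM wM mx (le_trans wz zx)).
Qed.

Let meet_path_roots a p : path meet a p ->
  all (fun b => [exists m in M, rt m == b]) p.
Proof.
elim: p a => // b p IHp a /= /andP[/exists_inP[s _ /andP[_ /exists_inP[m mM]]]].
case/andP=> _ mb /IHp ->; rewrite andbT.
by apply/exists_inP; exists m.
Qed.

(** Choose a witness for each edge. Two consecutive witnesses lie above a common component of [M],
    which is not [T] because the intermediate root is outside [T]. *)
Let meet_path_share a p t : path meet a (rcons p t) -> ~~ has (mem T) p ->
  exists s ss, [/\ size ss = size p, path share s ss, s \in A :\: M,
                   over s a & over (last s ss) t].
Proof.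
elim: p a => [|b p IHp] a /=.
  rewrite andbT => /exists_inP[s sA /andP[sa st]] _.
  by exists s, [::].
case/andP=> /exists_inP[s sA /andP[sa sb]] pp; rewrite negb_or => /andP[bT pT].
have [s' [ss [ssz sp s'A s'b sl]]] := IHp b pp pT.
exists s, (s' :: ss); rewrite /= ssz sp sA sa sl andbT; split=> //.
rewrite /share sA s'A /=.
case/exists_inP: sb => m mM /andP[ms /eqP mb].
case/exists_inP: s'b => m' m'M /andP[m's' /eqP m'b].
have mT : m \notin T by rewrite -rt_T mb.
apply/exists_inP; exists (M_class m); first exact: M_class_in.
apply/and3P; split.
- by apply: contraNneq mT => <-; apply: mem_M_class.
- by apply/exists_inP; exists m => //; apply: mem_M_class.
apply/exists_inP; exists m' => //; rewrite in_set -/M m'M; apply: N_M; apply/rtP.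
by rewrite mb m'b.
Qed.

(** Distinct roots in [a :: p] lie in distinct components of [M]: only [a] lies in [T], and any
    other component of [M] is contained in [N], so it has a single root. This gives the bound on the
    size of [S]. *)
Let size_roots a p : a \in M -> rt a = a -> a \in T -> uniq p ->
  ~~ has (mem T) p -> all (fun b => [exists m in M, rt m == b]) p ->
  (size p < #|M_components Q|)%N.
Proof.
move=> aM ra aT up pT /allP pr.
have apM b : b \in a :: p -> b \in M /\ rt b = b.
  rewrite in_cons => /orP[/eqP->//|/pr/exists_inP[m mM /eqP<-]].
  by rewrite rt_rt -(link_in (N_M (rt_link m))).
have pnT b : b \in p -> b \notin T.
  by move=> bp; apply: contra pT => bT; apply/hasP; exists b.
have ua : uniq (a :: p).
  by rewrite /= up andbT; apply/negP => /pnT; rewrite aT.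
have uM : uniq (map (@M_class d Q) (a :: p)).
  rewrite map_inj_in_uniq // => b c bp cp bc.
  have [bM rb] := apM b bp; have [cM rc] := apM c cp.
  have bCc : c \in M_class b by rewrite bc mem_M_class.
  have Cb := M_class_in bM.
  have aC z : z \in a :: p -> z \in T -> z = a.
    by rewrite in_cons => /orP[/eqP//|/pnT/negPf->].
  have eqT : (b \in T) = (c \in T).
    apply/idP/idP => H; first by rewrite (M_component_eq TM Cb H (mem_M_class bM)).
    by rewrite (M_component_eq TM Cb H bCc) mem_M_class.
  have [bT|bT] := boolP (b \in T).
    by rewrite (aC b) // (aC c) // -eqT.
  have CN : M_class b \subset N.
    apply/subsetP => z zC; rewrite in_setU in_setD orbC.
    rewrite (subsetP (M_component_sub Cb)) // andbT (contra _ bT) // => zT.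
    by rewrite (M_component_eq TM Cb zT zC) mem_M_class.
  rewrite -rb -rc; apply/eqP/rtP/(linkS CN).
  exact: M_component_linked Cb _ _ (mem_M_class bM) bCc.
rewrite -[(size p).+1]/(size (a :: p)) -(size_map (@M_class d Q)) cardE.
apply: uniq_leq_size => // C /mapP[b /apM[bM _] ->].
by rewrite mem_enum M_class_in.
Qed.

(** The vertices of the [share] path form a set [S] to which the tree downset condition applies with
    [T] left out. The generated downset [B] is connected, so [T :&: B] is connected; as [T :&: B]
    lies in [A], it joins the two roots inside [N]. *)
Let share_contra s ss a t : path share s ss -> s \in A :\: M ->
  (size ss < #|M_components Q|)%N -> over s a -> over (last s ss) t ->
  a \in T -> t \in T -> a = t.
Proof.
move=> sp sA ssz sa st aT tT; pose S := [set z in s :: ss].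
have SA : S \subset A :\: M.
  apply/subsetP => z; rewrite in_set; move: z; apply/allP.
  rewrite /= sA /=; elim: ss s sp {sA sa ssz st S} => //= s' ss IHs s.
  by case/andP=> /and3P[_ -> _] /IHs ->.
have sS : s \in S by rewrite in_set mem_head.
have SM : S \subset ~: M.
  by apply: subset_trans SA _; apply/subsetP => z; rewrite in_setD in_setC => /andP[].
have Sk : (1 <= #|S| <= #|M_components Q|)%N.
  apply/andP; split; first by apply/card_gt0P; exists s.
  by apply: (leq_trans _ ssz); rewrite cardsE; apply: (card_size (s :: ss)).
pose Ts := [set T' in M_components Q | T' :&: downset S != set0].
have inTs T' m z :
    T' \in M_components Q -> m \in T' -> z \in S -> m <= z -> T' \in Ts.
  move=> T'M mT' zS mz; rewrite in_set T'M; apply/set0Pn; exists m.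
  by rewrite in_setI mT'; apply/downsetP; exists z.
have [m mM /andP[ms /eqP ma]] := exists_inP sa.
have [m' m'M /andP[ms' /eqP mt]] := exists_inP st.
have lS : last s ss \in S by rewrite in_set mem_last.
have mT : m \in T by rewrite -rt_T ma.
have m'T : m' \in T by rewrite -rt_T mt.
have TTs : T \in Ts := inTs _ _ _ TM mT sS ms.
have := tdc SM Sk TTs; set B := downset _ => BT.
have Bd : is_downset B by apply: is_downset_downset.
have SB : S \subset B.
  exact: subset_trans (sub_downset S) (generated_downset_S S T).
have TB T' : T' \in Ts -> T' != T -> T' \subset B.
  exact: generated_downset_T.
(* Neighbors in [share] are joined through a component other than [T], and that component lies
   entirely in [B]. *)
have toS z : z \in S -> link B s z.
  rewrite in_set => zs; have pS : path (induced share S) s ss.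
    apply: (sub_in_path (P := mem S) _ _ sp) => [u v uS vS uv|].
      by rewrite /induced /= [_ \in _]uS [_ \in _]vS.
    by apply/allP => w ws; rewrite -[_ w]/(w \in S) in_set.
  have := path_connect pS zs; apply: (connect_homo (h := id)) => {zs z}u v.
  case/and3P=> uS vS /and3P[_ _ /exists_inP[T' T'M /and3P[nT]]].
  case/exists_inP=> w wT' wu /exists_inP[w' w'T' w'v].
  have T'B := TB T' (inTs _ _ _ T'M wT' uS wu) nT.
  apply: (link_trans (y := w)).
    by rewrite link_sym; apply: link_le wu => //; apply: (subsetP SB).
  apply: (link_trans (y := w')); last first.
    by apply: link_le w'v => //; apply: (subsetP SB).
  exact: linkS T'B (M_component_linked T'M wT' w'T').
have linkB z : z \in B -> link B s z.
  have dS w : w \in downset S -> link B s w.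
    case/downsetP=> v vS wv; apply: link_trans (toS v vS) _.
    by rewrite link_sym; apply: link_le wv => //; apply: (subsetP SB).
  case/generated_downset_le => [/dS//|[T' [T'Ts nT zT']]].
  have T'B := TB T' T'Ts nT; move: T'Ts; rewrite in_set => /andP[T'M].
  case/set0Pn=> w /setIP[wT' /dS sw]; apply: link_trans sw _.
  exact: linkS T'B (M_component_linked T'M wT' zT').
have ccB : cc B = 1.
  apply/eqP/cc1P => //; split; first by apply/set0Pn; exists s; apply: (subsetP SB).
  move=> u v uB vB; apply: (link_trans (y := s)); last exact: linkB.
  by rewrite link_sym; apply: linkB.
have /generated_downset_cc/(_ T TM) TBl := BT ccB.
have lm : link (T :&: B) m m'.
  apply: TBl; rewrite in_setI ?mT ?m'T /=.
    by apply: Bd ms (subsetP SB _ sS).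
  by apply: Bd ms' (subsetP SB _ lS).
(* Since [T] was left out of the generators, an element of [B] in [T] lies below [S], hence in
   [A]. *)
rewrite -ma -mt; apply/eqP/rtP/(linkS _ lm)/subsetP => z /setIP[zT zB].
rewrite in_setU in_setI zT /=; apply/orP; left.
case/generated_downset_le: zB => [/downsetP[w wS zw]|[T' [T'Ts nT zT']]].
  by move/(subsetP SA): wS => /setDP[wA _]; apply: Ad zw wA.
move: T'Ts; rewrite in_set => /andP[T'M _].
by case/eqP: nT; apply: M_component_eq zT' zT.
Qed.

(** Take a simple [meet] path from [rt x] to [rt y]. If it is not trivial, cut it at its first
    return [t] to [T]; the roots in between are distinct and outside [T], so [share_contra] gives
    [rt x = t], against simplicity. *)
Lemma linked_M_component : linked (T :&: A).
Proof.
move=> x y /setIP[xT xA] /setIP[yT yA]; apply: N_T => //; apply/rtP/eqP.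
have TM' z : z \in T -> z \in M by apply/subsetP/M_component_sub.
have := meet_connect xA yA (TM' x xT) (TM' y yT) (lexx x) (lexx y).
case/connectP=> p /shortenP[p' pp' up' _ {p}] lp.
(* Without a return to [T] the path is empty, since its endpoint [rt y] lies in [T]. *)
case pT: (has (mem T) p'); last first.
  case: p' lp pT {pp' up'} => // b p' lp /negP[]; apply/hasP.
  exists (last b p'); first exact: mem_last.
  rewrite -[_ (last _ _)]/(last b p' \in T).
  by rewrite -[last b p']/(last (rt x) (b :: p')) -lp rt_T.
move: pp' up'; case: {lp} (split_find pT) => t p1 p2 tT p1T.
rewrite cat_path => /andP[pp1 _] /= /andP[xp up].
have xt : rt x != t.
  by apply: contraNneq xp => ->; rewrite mem_cat mem_rcons mem_head.
have [s [ss [ssz sp sA sx st]]] := meet_path_share pp1 p1T.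
case/eqP: xt; apply: (share_contra sp sA) => //; last by rewrite rt_T.
rewrite ssz; apply: (size_roots (a := rt x)) => //.
- by rewrite -(link_in (N_M (rt_link x))) TM'.
- by rewrite rt_T.
- by move: up; rewrite cat_uniq rcons_uniq => /andP[/andP[]].
by have := meet_path_roots pp1; rewrite all_rcons => /andP[].
Qed.

End LinkedComponents.

(** * The tree quotient *)

Section TreeQuotient.
Local Open Scope order_scope.
Variables (d : Order.disp_t) (Q : finPOrderType d).
Implicit Types (x y z : Q) (A B D T : {set Q}) (X Y Z : tree_quotient Q)
  (E : {set tree_quotient Q}).
Let M := M_set Q.

Fact tree_class_subproof x : [set y in [set: Q] | tree_rel x y] \in tree_classes Q.
Proof. by apply/imsetP; exists x. Qed.

Definition tree_class x : tree_quotient Q :=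
  exist (fun C => C \in tree_classes Q) _ (tree_class_subproof x).

Lemma mem_tree_class x y : (y \in val (tree_class x)) = tree_rel x y.
Proof. by rewrite /= !inE. Qed.

Lemma tree_classE X x : x \in val X -> X = tree_class x.
Proof.
move=> xX; apply: (tree_quotient_eq xX (y := x)); last exact: tree_rel_refl.
by rewrite mem_tree_class tree_rel_refl.
Qed.

Lemma tree_class_surj X : exists x, X = tree_class x.
Proof.
by case: X => X XP; have /imsetP[x _ XE] := XP; exists x; apply: val_inj.
Qed.

Lemma tree_class_eq x y : (tree_class x == tree_class y) = tree_rel x y.
Proof.
apply/eqP/idP => [xy|xy].
  by rewrite -mem_tree_class xy mem_tree_class tree_rel_refl.
by apply/esym/tree_classE; rewrite mem_tree_class tree_rel_sym.
Qed.

Lemma tree_class_notin_M x y : y \notin M ->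
  tree_class x = tree_class y -> x = y.
Proof.
move=> yM /eqP; rewrite tree_class_eq tree_relE => /orP[/eqP//|/and3P[_]].
by rewrite (negPf yM).
Qed.

Lemma tree_quotient_leP X Y :
  reflect (exists x y, [/\ X = tree_class x, Y = tree_class y & x <= y]) (X <= Y).
Proof.
apply: (iffP (tree_leP X Y)) => -[x [y [xX yY xy]]]; exists x, y; split=> //.
- exact: tree_classE.
- exact: tree_classE.
- by rewrite xX mem_tree_class tree_rel_refl.
by rewrite yY mem_tree_class tree_rel_refl.
Qed.

Lemma le_tree_class x y : x <= y -> tree_class x <= tree_class y.
Proof. by move=> xy; apply/tree_quotient_leP; exists x, y. Qed.

(** A class inside [M] is minimal in the quotient, because everything below an element of [M] is in
    the same class. So [y] is outside [M] and alone in its class. *)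
Lemma lt_tree_class X y : X < tree_class y ->
  y \notin M /\ exists2 x, X = tree_class x & x <= y.
Proof.
rewrite lt_neqAle => /andP[nXy /tree_quotient_leP[x [y' [XE yE xy']]]].
have y'M : y' \notin M.
  apply: contra nXy => y'M; rewrite XE yE tree_class_eq.
  exact: M_set_le.
by rewrite (tree_class_notin_M y'M yE); split=> //; exists x.
Qed.

Lemma link_tree_class D E x y : {in D, forall x, tree_class x \in E} ->
  link D x y -> link E (tree_class x) (tree_class y).
Proof.
move=> DE; apply: connect_homo => u v /and3P[uD vD uv]; apply: connect1.
rewrite /induced /= !DE //; case/orP: uv => /le_tree_class uv.
  by rewrite /Order.comparable uv.
by rewrite /Order.comparable uv orbT.
Qed.

Lemma linked_tree_class D : linked D -> linked [set tree_class x | x in D].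
Proof.
move=> Dl _ _ /imsetP[x xD ->] /imsetP[y yD ->].
apply: link_tree_class (Dl _ _ xD yD) => z zD; exact: imset_f.
Qed.

Lemma link_same_class E x y : tree_class x = tree_class y -> tree_class x \in E ->
  link [set z | tree_class z \in E] x y.
Proof.
move=> /eqP; rewrite tree_class_eq => xy xE.
move: (xy); rewrite tree_relE => /orP[/eqP->|]; first exact: link_refl.
case/and3P=> xM yM; rewrite -link_hasse_M // => lxy.
have := link_component (M_class_in xM) (mem_M_class xM) lxy; apply: linkS.
apply/subsetP => z /setIdP[zM xz]; rewrite in_set.
suff /eqP<- : tree_class x == tree_class z by [].
by rewrite tree_class_eq tree_relE xM zM -link_hasse_M // xz orbT.
Qed.

(** A path of classes lifts: each edge has comparable representatives, and representatives of one
    class are joined inside that class by [link_same_class]. *)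
Lemma linked_preim E : linked E -> linked [set z | tree_class z \in E].
Proof.
move=> El x y; rewrite !inE => xE yE.
case/connectP: (El _ _ xE yE) => p; elim: p x xE => [|Z p IHp] x xE /=.
  by move=> _ /esym yx; apply: link_same_class.
case/andP=> /and3P[_ ZE xZ] pp yl.
have [u [v [uE vE uv]]] : exists u v,
    [/\ tree_class x = tree_class u, Z = tree_class v & u >=< v].
  case/orP: xZ => /tree_quotient_leP[u [v [uE vE uv]]]; [exists u, v|exists v, u].
    by rewrite /Order.comparable uv.
  by rewrite /Order.comparable uv orbT.
rewrite vE in ZE pp yl; apply: link_trans (IHp v ZE pp yl).
apply: link_trans (link_same_class uE xE) _; apply: connect1.
by rewrite /induced /= !inE -uE xE ZE.
Qed.

(** Preimages of connected downsets are connected downsets, preimage commutes with intersection, and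
    images of linked sets are linked. *)
Lemma intersecting_tree_quotient :
  intersecting Q -> intersecting (tree_quotient Q).
Proof.
move=> QI E F Ed Fd El Fl.
pose pre (G : {set tree_quotient Q}) := [set z | tree_class z \in G].
have pred G : is_downset G -> is_downset (pre G).
  by move=> Gd x y xy; rewrite !inE => yG; apply: Gd yG; apply: le_tree_class.
have preI : pre (E :&: F) = pre E :&: pre F by apply/setP => z; rewrite !inE.
have -> : E :&: F = [set tree_class x | x in pre (E :&: F)].
  apply/setP => X; have [x ->] := tree_class_surj X.
  apply/idP/imsetP => [xE|[y]]; first by exists x; rewrite // inE.
  by rewrite inE => yE ->.
apply: linked_tree_class; rewrite preI.
by apply: QI; [exact: pred|exact: pred|exact: linked_preim|exact: linked_preim].
Qed.

(** A path between classes in the intersection of the images is lifted to [A :&: B]: [edge] lifts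
    its strict steps, and [same] joins elements of [A :&: B] in one class. *)
Lemma intersecting_of_tree_quotient : M_acyclic Q ->
  (forall A T, is_downset A -> linked A -> T \in M_components Q ->
     linked (T :&: A)) ->
  intersecting (tree_quotient Q) -> intersecting Q.
Proof.
move=> ac MA QI A B Ad Bd Al Bl x y xD yD.
pose im (D : {set Q}) := [set tree_class x | x in D].
have imd D : is_downset D -> is_downset (im D).
  move=> Dd X Y XY /imsetP[z zD YE]; move: XY; rewrite YE le_eqVlt => /orP[/eqP->|].
    exact: imset_f.
  by case/lt_tree_class => _ [w -> wz]; apply: imset_f; apply: Dd zD.
have El : linked (im A :&: im B).
  by apply: QI; [apply: imd|apply: imd|apply: linked_tree_class..].
have inE' z : z \in A :&: B -> tree_class z \in im A :&: im B.
  by case/setIP=> zA zB; rewrite inE !imset_f.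
(* A nontrivial class is a tree that meets [A] and [B] in connected pieces, and subtrees of a tree
   meet in a subtree. *)
have same u v : u \in A :&: B -> v \in A :&: B -> tree_class u = tree_class v ->
    link (A :&: B) u v.
  move=> /setIP[uA uB] /setIP[vA vB] /eqP; rewrite tree_class_eq tree_relE.
  case/orP=> [/eqP->|]; first exact: link_refl.
  case/and3P=> uM vM; rewrite -link_hasse_M // => uv.
  have CM := M_class_in uM; have uC := mem_M_class uM.
  have vC : v \in M_class u by rewrite inE -/M vM.
  have CAM C D : C \in M_components Q -> C :&: D \subset M.
    by move=> /M_component_sub; apply: subset_trans; apply: subsetIl.
  have lA : link (M_class u :&: A) u v by apply: MA; rewrite // in_setI ?uC ?vC.
  have lB : link (M_class u :&: B) u v by apply: MA; rewrite // in_setI ?uC ?vC.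
  rewrite !link_hasse_M ?CAM // in lA lB.
  have := acyclic_connectI (hasse_in_sym M) ac lA lB.
  rewrite -link_hasse_M; last exact: subset_trans (subsetIl _ _) (CAM _ _ CM).
  by apply: linkS; apply: setISS; apply: subsetIr.
(* The upper class is the singleton of [y0], so [y0] itself is in both [A] and [B], and so is
   everything below it. *)
have edge X y0 : tree_class y0 \in im A :&: im B -> X < tree_class y0 ->
    exists2 x0, X = tree_class x0 &
    [/\ x0 \in A :&: B, y0 \in A :&: B & x0 <= y0].
  move=> /setIP[/imsetP[a aA aE] /imsetP[b bB bE]].
  case/lt_tree_class => y0M [x0 XE xy0]; exists x0 => //.
  have y0a : y0 = a by apply/esym/(tree_class_notin_M y0M).
  have y0b : y0 = b by apply/esym/(tree_class_notin_M y0M).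
  rewrite -y0a in aA; rewrite -y0b in bB.
  by rewrite !in_setI aA bB (Ad _ _ xy0 aA) (Bd _ _ xy0 bB).
case/connectP: (El _ _ (inE' x xD) (inE' y yD)) => p.
elim: p x xD => [|Z p IHp] x xD /=; first by move=> _ /esym; apply: same.
case/andP=> /and3P[xE ZE xZ] pp yl.
have [xZE|nxZ] := eqVneq (tree_class x) Z.
  by rewrite -xZE in pp yl; apply: IHp.
have [z ZEz] := tree_class_surj Z; rewrite ZEz in ZE nxZ xZ pp yl.
have [u [v [uD vD uE vE uv]]] : exists u v, [/\ u \in A :&: B, v \in A :&: B,
    tree_class x = tree_class u, tree_class z = tree_class v & u >=< v].
  move: xZ; rewrite /Order.comparable !le_eqVlt (negPf nxZ) eq_sym (negPf nxZ) /=.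
  case/orP=> [/(edge _ z ZE)[u uE [uD zD uz]]|/(edge _ x xE)[v vE [vD _ vx]]].
    by exists u, z; rewrite /Order.comparable uz.
  by exists x, v; rewrite /Order.comparable vx orbT.
rewrite vE in pp yl; apply: link_trans (IHp v vD pp yl).
apply: link_trans (same x u xD uD uE) _; apply: connect1.
by rewrite /induced /= uD vD uv.
Qed.

(** At most one class of a chain [C] lies in [M]; the others are singletons forming a chain [D]
    outside [M]. The least element [y] of [D] is not in [M], so two further elements [z < w < y]
    extend [D] to a chain longer than [C]. *)
Lemma poset_length_tree_quotient :
  (poset_length (tree_quotient Q) <= (poset_length Q).-1)%N.
Proof.
apply/bigmax_leqP => C /forall_inP Cc.
have Ccmp X Y : X \in C -> Y \in C -> X >=< Y.
  by move=> /Cc/forall_inP; apply.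
pose D := [set z | tree_class z \in C] :\: M.
(* The case of at most one class is separate, because the construction needs a nonempty [D]. *)
have [C1|C1] := leqP #|C| 1; first by case: (#|C|) C1 => [|[|]].
have CD : (#|C| <= #|D|.+1)%N.
  have := cardsID [set tree_class z | z in D] C; move=> <-.
  rewrite -addn1; apply: leq_add.
    apply: leq_trans (leq_imset_card _ _).
    by apply: subset_leq_card; apply: subsetIr.
  apply/card_le1_eqP => X Y /setDP[XC XD] /setDP[YC YD].
  wlog XY : X Y XC XD YC YD / X <= Y.
    by move=> H; case/orP: (Ccmp X Y XC YC) => XY; [|apply/esym]; apply: H.
  move: XY; rewrite le_eqVlt => /orP[/eqP//|].
  have [y yE] := tree_class_surj Y; rewrite yE => /lt_tree_class[yM _].
  by case/negP: YD; apply/imsetP; exists y; rewrite // in_setD yM in_set -yE.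
have Dc : {in D &, forall x y, x >=< y}.
  move=> x y /setDP[+ xM] /setDP[+ yM]; rewrite !in_set => xC yC.
  have lt u v : u \notin M -> tree_class u < tree_class v -> u <= v.
    by move=> uM /lt_tree_class[_ [w /esym/(tree_class_notin_M uM) ->]].
  have [/(tree_class_notin_M yM)->|nxy] := eqVneq (tree_class x) (tree_class y).
    by rewrite /Order.comparable lexx.
  case/orP: (Ccmp _ _ xC yC); rewrite le_eqVlt ?[tree_class y == _]eq_sym (negPf nxy).
    by move/(lt _ _ xM) => xy; rewrite /Order.comparable xy.
  by move/(lt _ _ yM) => yx; rewrite /Order.comparable yx orbT.
have [x0 x0D] : exists x, x \in D.
  by apply/card_gt0P; rewrite -ltnS (leq_trans C1).
have [y yD ymin] := arg_minnP (fun w => #|[set v | v <= w]|) x0D.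
have yle x : x \in D -> y <= x.
  move=> xD; case/orP: (Dc _ _ yD xD) => // ; rewrite le_eqVlt => /orP[/eqP->//|xy].
  have := ymin x xD; rewrite leqNgt => /negP[].
  apply: proper_card; apply/properP; split; last first.
    by exists y; rewrite inE ?lexx // (lt_geF xy).
  by apply/subsetP => w; rewrite !inE => /le_trans->//; apply: ltW.
have [w [z [zw wy]]] : exists w z, z < w /\ w < y.
  have /setDP[_] : y \in D := yD; rewrite inE => /forallPn[w].
  rewrite negb_imply => /andP[/and4P[_ _ wy _] /forallPn[z]]; rewrite negbK => zw.
  by exists w, z.
have zy := lt_trans zw wy.
have wD : w \notin D by apply/negP => /yle; rewrite (lt_geF wy).
have zD : z \notin w |: D.
  by rewrite !in_setU1 (lt_eqF zw) /=; apply/negP => /yle; rewrite (lt_geF zy).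
have chain : is_chain (z |: (w |: D)).
  have cmp u : u \in z |: (w |: D) ->
      [/\ u >=< z, u >=< w & {in D, forall v, u >=< v}].
    have wx x : x \in D -> w <= x by move=> /yle; apply: le_trans; apply: ltW.
    have zx x : x \in D -> z <= x by move=> /yle; apply: le_trans; apply: ltW.
    rewrite /Order.comparable; case/setU1P=> [->|/setU1P[->|uD]].
    - by rewrite lexx ltW //; split=> // v /zx->.
    - by rewrite lexx [z <= w]ltW // orbT; split=> // v /wx->.
    by rewrite zx // wx // !orbT; split=> // v vD; apply: Dc.
  apply/forall_inP => u /cmp[uz uw uD]; apply/forall_inP => v.
  by case/setU1P=> [->//|/setU1P[->//|/uD]].
have : (#|z |: (w |: D)|.-1 <= poset_length Q)%N.
  exact: (leq_bigmax_cond (F := fun S : {set Q} => #|S|.-1) _ chain).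
rewrite !cardsU1 zD wD /= !add1n /= => lQ.
by rewrite -!subn1 leq_sub2r // (leq_trans CD).
Qed.

End TreeQuotient.

(** * Weights on downsets *)

Section DownsetWeights.
Local Open Scope ring_scope.
Variables (d : Order.disp_t) (Q : finPOrderType d).
Implicit Types (x y z : Q) (A B D : {set Q}).

(** [D0] selects the downsets concerned: those avoiding the top, those inside a given downset, or
    all. *)
Definition downset_weight (D0 : {set Q} -> Prop) (f : Q -> int) :=
  forall D, is_downset D -> linked D -> D != set0 -> D0 D -> \sum_(x in D) f x = 1.

Definition link_class D x := [set y in D | link D x y].

Lemma link_class_downset D x : is_downset D -> is_downset (link_class D x).
Proof.
move=> Dd y z yz; rewrite !inE => /andP[zD xz]; rewrite (Dd _ _ yz zD) /=.
by apply: link_trans xz _; rewrite link_sym; apply: link_le yz.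
Qed.

Lemma link_class_linked D x : x \in D -> linked (link_class D x).
Proof.
move=> xD; suff lx y : y \in link_class D x -> link (link_class D x) x y.
  by move=> y z /lx xy /lx; apply: link_trans; rewrite link_sym.
rewrite inE => /andP[_ /connectP[p + ->{y}]].
elim/last_ind: p => [|p z IHp]; first by rewrite link_refl.
rewrite rcons_path last_rcons => /andP[pp /and3P[lD zD lz]].
have xl : link D x (last x p) by apply/connectP; exists p.
apply: link_trans (IHp pp) _; apply: connect1.
rewrite /induced /= !inE lD zD xl lz /= andbT.
by apply: link_trans xl _; apply: connect1; rewrite /induced /= lD zD.
Qed.

(** The components of a downset are connected downsets, and each contributes 1. *)
Lemma sum_downset_cc D f : is_downset D ->
  downset_weight (fun B => B \subset D) f ->
  \sum_(x in D) f x = (cc D)%:R.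
Proof.
move=> Dd fD; have se := hasse_in_sym [set: Q].
have part : partition (components (@hasse d Q) D) D.
  apply: equivalence_partitionP => x y z _ _ _; split; first exact: connect0.
  by move=> xy; apply: same_connect (induced_connect_sym D se) _ _ xy z.
rewrite (set_partition_big _ part) /= (eq_bigr (fun=> 1)) ?sumr_const // => U UD.
have [x xU] := component_nonempty UD; have [xD UE] := componentP se UD xU.
have -> : U = link_class D x.
  by rewrite UE; apply/setP => y; rewrite !inE -link_hasse.
apply: fD.
- exact: link_class_downset.
- exact: link_class_linked.
- by apply/set0Pn; exists x; rewrite inE xD link_refl.
- by apply/subsetP => y; rewrite inE => /andP[].
Qed.

Lemma sum_setU_setI A B (f : Q -> int) :
  \sum_(x in A :|: B) f x + \sum_(x in A :&: B) f x =
  \sum_(x in A) f x + \sum_(x in B) f x.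
Proof.
rewrite (big_setID A) /= (setIidPr (subsetUl A B)) setDUl setDv set0U.
rewrite [\sum_(x in B) f x](big_setID A) /= [B :&: A]setIC -addrA.
by rewrite [X in _ + X = _]addrC.
Qed.

Lemma intersecting_of_weight top f : (forall x : Q, (x <= top)%O) ->
  downset_weight (fun D => top \notin D) f -> intersecting Q.
Proof.
move=> topP fD A B Ad Bd Al Bl.
(* A downset containing the top is everything, so [A] and [B] may be assumed to avoid it. *)
have topE D : is_downset D -> top \in D -> D = setT.
  by move=> Dd tD; apply/setP => x; rewrite inE (Dd _ _ (topP x)).
have [tA|tA] := boolP (top \in A); first by rewrite (topE A) // setTI.
have [tB|tB] := boolP (top \in B); first by rewrite (topE B) // setIT.
have [->|/set0Pn[x /setIP[xA xB]]] := eqVneq (A :&: B) set0.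
  by move=> x y; rewrite inE.
have ABd : is_downset (A :&: B) by apply: downset_setI.
suff /cc1P[] : cc (A :&: B) == 1%N by [].
have n0 (D : {set Q}) : x \in D -> D != set0 by move=> xD; apply/set0Pn; exists x.
have := sum_setU_setI A B f; rewrite (fD A) ?(fD B) ?(fD (A :|: B)) //.
- move/addrI; rewrite sum_downset_cc // => [/eqP|D Dd Dl D0 DAB].
    by rewrite pnatr_eq1.
  by apply: fD => //; apply: contra tA => /(subsetP DAB)/setIP[].
- exact: downset_setU.
- exact: linkedU xA xB Al Bl.
- by apply: n0; rewrite inE xA.
- by rewrite inE negb_or tA.
- exact: n0 xB.
- exact: n0 xA.
Qed.

(** Recursion along the order: a maximal element [x] of a downset is removed, and its value is then
    forced by the values strictly below it. Changing [f] at [x] leaves the other sums intact, as no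
    other element of the downset is above [x]. *)
Lemma exists_weight1 : exists f : Q -> int,
  forall x, \sum_(y | (y <= x)%O) f y = 1.
Proof.
suff [f fP] : exists f : Q -> int, forall x, x \in setT ->
    \sum_(y | (y <= x)%O) f y = 1.
  by exists f => x; apply: fP.
have : is_downset [set: Q] by [].
have [n] := ubnP #|[set: Q]|; elim: n [set: Q] => // n IHn D Dn Dd.
have [->|/set0Pn[x0 x0D]] := eqVneq D set0.
  by exists (fun=> 0) => x; rewrite inE.
have [x xD' xmax] := arg_maxnP (fun w => #|[set v | (v <= w)%O]|) x0D.
have xD : x \in D := xD'.
have nlt y : y \in D -> ~~ (x < y)%O.
  move=> yD; apply/negP => xy; have := xmax y yD; apply/negP; rewrite -ltnNge.
  apply: proper_card; apply/properP; split; last first.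
    by exists y; rewrite inE ?lexx // (lt_geF xy).
  by apply/subsetP => w; rewrite !inE => /le_trans->//; apply: ltW.
have [||f fP] := IHn (D :\ x).
- by rewrite (cardsD1 x) xD in Dn.
- move=> y z yz /setD1P[nzx zD]; apply/setD1P; split; last exact: Dd yz zD.
  apply: contra (nlt z zD) => /eqP yx.
  by rewrite lt_neqAle eq_sym nzx -yx.
exists (fun y => if y == x then 1 - \sum_(z | (z < x)%O) f z else f y) => y yD.
have [->|nyx] := eqVneq y x.
  rewrite (bigD1 x) //= eqxx -[RHS](subrK (\sum_(z | (z < x)%O) f z)); congr (_ + _).
  apply: eq_big => z; first by rewrite lt_neqAle andbC.
  by case/andP=> _ /negPf->.
rewrite -[RHS](fP y); last by rewrite !inE nyx.
apply: eq_bigr => z zy; case: eqVneq => // zx; have := nlt y yD.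
by rewrite lt_neqAle eq_sym nyx -zx zy.
Qed.

Lemma weight_of_intersecting :
  intersecting Q -> exists f, downset_weight (fun=> True) f.
Proof.
move=> QI; have [f f1] := exists_weight1; exists f => D Dd Dl Dn0 _.
have [n] := ubnP #|D|; elim: n D Dd Dl Dn0 => // n IHn D Dd Dl /set0Pn[x0 x0D] Dn.
have sum1 x : \sum_(y in downset [set x]) f y = 1.
  rewrite -(f1 x); apply: eq_bigl => y; apply/downsetP/idP => [[_ /set1P->]//|yx].
  by exists x; rewrite ?set11.
(* Enlarge [A] by the principal downset of some [b] outside [A] and above an element of [A]. The
   overlap is connected and smaller than [D], so the outer induction gives it weight 1. *)
have grow A m : (#|D :\: A| < m)%N -> is_downset A -> linked A -> A != set0 ->
    A \subset D -> \sum_(x in A) f x = 1 -> \sum_(x in D) f x = 1.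
  elim: m A => // m IHm A Am Ad Al /set0Pn[x xA] AD A1.
  have [DA|] := boolP (D \subset A).
    by have -> : D = A by apply/eqP; rewrite eqEsubset DA.
  case/subsetPn=> y yD yA.
  have [a [b [aA bD bA ab]]] := linked_cross Dl AD xA yD yA.
  have alb : (a <= b)%O by case/orP: ab => // /Ad/(_ aA) bA'; rewrite bA' in bA.
  have Bd := @is_downset_downset _ _ [set b].
  have aB : a \in downset [set b] by apply/downsetP; exists b; rewrite ?set11.
  have bB : b \in downset [set b] by apply/downsetP; exists b; rewrite ?set11.
  have BD : downset [set b] \subset D by apply: downset_min; rewrite ?sub1set.
  apply: (IHm (A :|: downset [set b])).
  - apply: leq_trans (_ : #|D :\: A| <= m)%N; last by rewrite -ltnS.
    apply: proper_card; apply/properP; split; first by apply: setDS; apply: subsetUl.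
    by exists b; rewrite inE ?bA //= in_setU bB orbT.
  - exact: downset_setU.
  - exact: linkedU aA aB Al (@linked_downset1 _ _ b).
  - by apply/set0Pn; exists x; rewrite inE xA.
  - by rewrite subUset AD.
  have := sum_setU_setI A (downset [set b]) f; rewrite A1 sum1 (IHn (A :&: _)).
  - by move/addIr.
  - exact: downset_setI.
  - by apply: QI => //; apply: linked_downset1.
  - by apply/set0Pn; exists a; rewrite inE aA.
  apply: leq_trans (_ : #|D| <= n)%N; last by rewrite -ltnS.
  apply: proper_card; apply/properP; split.
    by apply: subset_trans AD; apply: subsetIl.
  by exists b; rewrite // inE (negPf bA).
apply: (grow (downset [set x0]) #|D :\: downset [set x0]|.+1) => //.
- exact: is_downset_downset.
- exact: linked_downset1.
- by apply/set0Pn; exists x0; apply/downsetP; exists x0; rewrite ?set11.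
by apply: downset_min; rewrite ?sub1set.
Qed.

End DownsetWeights.

(** * Rays of the braid cone *)

Section Gaps.
Local Open Scope ring_scope.
Local Open Scope quotient_scope.
Variables (T : finType) (A : comNzRingType).
Implicit Types (x y : mod_const T A) (i j : T) (D : {set T}).

(* Coordinates of [mod_const T A] are only defined up to a common shift, but
   their differences are well defined. *)
Definition gap i j x : A := repr x j - repr x i.

Lemma gap_pi i j (f : {ffun T -> A}) : gap i j (\pi_(mod_const T A) f) = f j - f i.
Proof.
have /eqP/mod_const_eqP/(_ i j) H := reprK (\pi_(mod_const T A) f).
rewrite /gap -[X in X - _](subrK (f j)) -H.
by rewrite addrAC [_ - _ - _]addrAC subrr sub0r addrC.
Qed.

Lemma gap_trans i j k x : gap i j x + gap j k x = gap i k x.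
Proof. by rewrite /gap addrC subrKA. Qed.

Lemma gap_base k i j x : gap i j x = gap k j x - gap k i x.
Proof. by rewrite -(gap_trans k i j) addrC addKr. Qed.

Lemma gap_opp i j x : gap i j x = - gap j i x.
Proof. by rewrite /gap opprB. Qed.

Lemma gap_inj x y : (forall i j, gap i j x = gap i j y) -> x = y.
Proof.
move=> xy; rewrite -[x]reprK -[y]reprK; apply/eqP/mod_const_eqP => i j.
rewrite -[repr x j](subrK (repr x i)) [repr x j - _](xy i j) /gap.
by rewrite addrAC [_ - _ - repr y j]addrAC subrr sub0r addrC.
Qed.

Lemma gap_is_linear i j : linear (gap i j : mod_const T A -> A^o).
Proof.
move=> a x y; rewrite -[x]reprK -[y]reprK.
rewrite [a *: _]pi_mod_const_scale -raddfD !gap_pi !ffunE.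
by rewrite scalerBr opprD addrACA.
Qed.
HB.instance Definition _ i j :=
  GRing.isLinear.Build A (mod_const T A) A^o _ (gap i j : mod_const T A -> A^o)
    (gap_is_linear i j).

Definition indicator (D : {set T}) : mod_const T A :=
  \pi [ffun i => (i \in D)%:R].

Lemma gap_indicator i j D : gap i j (indicator D) = (j \in D)%:R - (i \in D)%:R.
Proof. by rewrite gap_pi !ffunE. Qed.

(** Supplies the functional cutting out a face: when all its gaps are nonnegative, it vanishes only
    if each gap does. *)
Definition gap_sum (S : {set T * T}) x : A^o := \sum_(p in S) gap p.1 p.2 x.

Lemma gap_sum_is_linear S : linear (gap_sum S).
Proof.
move=> a x y; rewrite /gap_sum scaler_sumr -big_split; apply: eq_bigr => p _.
by rewrite linearP.
Qed.
HB.instance Definition _ S :=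
  GRing.isLinear.Build A (mod_const T A) A^o _ (gap_sum S) (gap_sum_is_linear S).

(** The dual lattice vector attached to a weight [f]; gaps make it well defined modulo constants. *)
Definition weighted_gap (f : T -> A) (j : T) x : A := \sum_i f i * gap i j x.

Fact weighted_gap_is_zmod_morphism f j : zmod_morphism (weighted_gap f j).
Proof.
move=> x y; rewrite /weighted_gap -sumrB; apply: eq_bigr => i _.
by rewrite -mulrBr -(raddfB (gap i j)).
Qed.
HB.instance Definition _ f j := GRing.isZmodMorphism.Build (mod_const T A) A
  (weighted_gap f j) (weighted_gap_is_zmod_morphism f j).

Lemma weighted_gap_indicator f j D : j \notin D ->
  weighted_gap f j (indicator (~: D)) = \sum_(i in D) f i.
Proof.
move=> jD; rewrite /weighted_gap [RHS]big_mkcond; apply: eq_bigr => i _.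
rewrite gap_indicator !in_setC (negPf jD); case: (i \in D).
  by rewrite subr0 mulr1.
by rewrite subrr mulr0.
Qed.

Lemma indicator_setC D : indicator (~: D) = - indicator D.
Proof.
apply: gap_inj => i j; rewrite raddfN /= !gap_indicator !in_setC.
by case: (i \in D); case: (j \in D);
  rewrite /= ?mulr0n ?subrr ?subr0 ?sub0r ?opprK ?oppr0.
Qed.

Lemma indicator_sum D : indicator D = \sum_(i in D) indicator [set i].
Proof.
apply: gap_inj => i j; rewrite raddf_sum gap_indicator.
have S k : \sum_(l in D) (k \in [set l])%:R = (k \in D)%:R :> A.
  have [kD|kD] := boolP (k \in D); last first.
    by rewrite big1 // => l lD; rewrite inE; case: eqVneq kD => // ->; rewrite lD.
  rewrite (bigD1 k) //= set11 big1 ?addr0 // => l /andP[_ lk].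
  by rewrite inE eq_sym (negPf lk).
by rewrite -!S -sumrB; apply: eq_bigr => k _; rewrite /= gap_indicator.
Qed.

End Gaps.

(** * Ray generators of the braid cone and the Gorenstein condition *)

Section BraidConeRays.
Local Open Scope ring_scope.
Variables (R : realType) (d : Order.disp_t) (P : finPOrderType d) (top : P).
Hypothesis topP : forall x : P, (x <= top)%O.
Implicit Types (x y : mod_const P R) (v w : mod_const P int) (D : {set P}).
Let emb := @lattice_emb R d P.

Lemma gap_lattice_emb i j v : gap i j (emb v) = (gap i j v)%:~R.
Proof. by rewrite /emb /lattice_emb gap_pi !ffunE -intrB. Qed.

Lemma lattice_emb_indicator D : emb (indicator int D) = indicator R D.
Proof.
apply: gap_inj => i j; rewrite gap_lattice_emb !gap_indicator.
by rewrite rmorphB /= !rmorph_nat.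
Qed.

Lemma braid_coneP x :
  braid_cone x <-> forall i j : P, (i < j)%O -> 0 <= gap i j x.
Proof. by split=> H i j /H; rewrite /gap subr_ge0. Qed.

Lemma braid_cone_indicator D : is_downset D -> braid_cone (indicator R (~: D)).
Proof.
move=> Dd; apply/braid_coneP => i j /ltW ij; rewrite gap_indicator !in_setC.
have := Dd i j ij; case: (i \in D); case: (j \in D) => //= H;
  rewrite ?subrr ?subr0 ?ler01 //.
by have := H isT.
Qed.

(** The face [F] kills the gaps of related pairs on the same side of [D]. Its points are constant on
    [D], which is connected, and on the complement, where everything is below [top]; so [F] is
    spanned by the indicator. *)
Lemma ray_generator_indicator D : is_downset D -> linked D -> D != set0 ->
  top \notin D -> is_ray_generator emb (@braid_cone R d P) (indicator int (~: D)).
Proof.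
move=> Dd Dl /set0Pn[i0 i0D] tD.
pose S := [set p : P * P | (p.1 < p.2)%O && ((p.1 \in D) == (p.2 \in D))].
pose u : {linear mod_const P R -> R^o} := gap_sum S.
pose F x := braid_cone x /\ u x = 0.
have side x i j : F x -> (i < j)%O -> (i \in D) = (j \in D) -> gap i j x = 0.
  case=> /braid_coneP xs ux ij ijD.
  have gS (p : P * P) : p \in S -> 0 <= gap p.1 p.2 x by rewrite inE => /andP[/xs].
  have ux' : \sum_(p in S) gap p.1 p.2 x = 0 := ux.
  by have := psumr_eq0P gS ux'; move/(_ (i, j)); apply; rewrite inE /= ij ijD eqxx.
have constD x i : F x -> i \in D -> gap i0 i x = 0.
  move=> Fx iD; have /connectP[p pp ->] := Dl _ _ i0D iD.
  elim/last_ind: p pp => [|p j IHp]; first by rewrite /gap subrr.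
  rewrite rcons_path last_rcons => /andP[/IHp pE /and3P[lD jD lj]].
  rewrite -(gap_trans _ (last i0 p)) pE add0r.
  have [->|nlj] := eqVneq (last i0 p) j; first by rewrite /gap subrr.
  move: lj; rewrite /Order.comparable !le_eqVlt (negPf nlj) eq_sym (negPf nlj) /=.
  case/orP=> lj; first by apply: side Fx lj _; rewrite lD jD.
  by rewrite gap_opp (side _ _ _ Fx lj) ?oppr0 // lD jD.
have constC x i : F x -> i \notin D -> gap i top x = 0.
  move=> Fx iD; have [->|nit] := eqVneq i top; first by rewrite /gap subrr.
  by apply: side Fx _ _; rewrite ?lt_neqAle ?nit ?topP // (negPf iD) (negPf tD).
have gapE x i : F x -> gap i0 i x = (i \notin D)%:R * gap i0 top x.
  move=> Fx; have [iD|iD] := boolP (i \in D); first by rewrite constD ?mul0r.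
  by rewrite mul1r -(gap_trans i0 i top) (constC _ _ Fx iD) addr0.
have FE x (c : R) : F x -> gap i0 top x = c -> x = c *: indicator R (~: D).
  move=> Fx xc; apply: gap_inj => i j; rewrite linearZ /= gap_indicator !in_setC.
  by rewrite (gap_base i0 i j) (gapE _ i Fx) (gapE _ j Fx) xc -mulrBl [RHS]mulrC.
have Find : F (indicator R (~: D)).
  split; first exact: braid_cone_indicator.
  rewrite /u /= /gap_sum big1 // => -[i j]; rewrite inE /= => /andP[_ /eqP ijD].
  by rewrite gap_indicator !in_setC ijD subrr.
have gap1 (A : comNzRingType) : gap i0 top (indicator A (~: D)) = 1.
  by rewrite gap_indicator !in_setC tD i0D subr0.
have i0top : (i0 < top)%O.
  by rewrite lt_neqAle topP andbT; apply: contraNneq tD => <-.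
exists F; split.
- split.
    exists u => //; move=> x /braid_coneP xs; apply: sumr_ge0 => p.
    by rewrite inE => /andP[/xs].
  exists (indicator R (~: D)); split=> //.
    apply/eqP => E; have := gap1 R; rewrite E raddf0 => /eqP.
    by rewrite eq_sym oner_eq0.
  by move=> y Fy; exists (gap i0 top y); apply: FE.
- by rewrite lattice_emb_indicator.
(* The multiple is the gap across [D], a nonnegative integer since [i0] is below [top]. *)
move=> w Fw; exists (absz (gap i0 top w)).
have c0 : 0 <= gap i0 top w.
  by have [/braid_coneP/(_ _ _ i0top)] := Fw; rewrite gap_lattice_emb ler0z.
apply: gap_inj => i j; rewrite raddfMn /= gap_indicator.
apply: (@intr_inj R); rewrite -gap_lattice_emb (FE _ _ Fw (erefl _)) linearZ /=.
rewrite gap_indicator gap_lattice_emb -{1}(gez0_abs c0).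
by rewrite rmorphMn /= rmorphB /= !rmorph_nat -[RHS]mulr_natl -pmulrn.
Qed.

(** Let [x] span the ray, [D] be the set where [x] is least, [D1] a component of [D] and [e] the
    smallest positive gap above [D]. Subtracting [e] times the indicator of [~: D1] from [x] stays
    in the cone, so the functional [u] of the face vanishes on that indicator, which therefore lies
    on the ray. *)
Lemma ray_generatorE v : is_ray_generator emb (@braid_cone R d P) v ->
  exists D, [/\ is_downset D, linked D, D != set0, top \notin D &
    v = indicator int (~: D)].
Proof.
case=> F [[[u u0 FE] [x [Fx xn0 _]]] Fv Fw].
have [/[dup] xs /braid_coneP xs' ux] := (FE x).1 Fx.
have xle i j : (i <= j)%O -> 0 <= gap i j x.
  by rewrite le_eqVlt => /orP[/eqP->|/xs'//]; rewrite /gap subrr.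
have [i0 _ imin] := arg_minP (fun i => repr x i) (erefl : xpredT top).
have gmin i : 0 <= gap i0 i x by rewrite subr_ge0; apply: imin.
pose D := [set i | gap i0 i x == 0].
have Dd : is_downset D.
  move=> i j ij; rewrite !inE => /eqP j0; rewrite eq_le gmin andbT -j0.
  by rewrite -(gap_trans i0 i j) lerDl xle.
have i0D : i0 \in D by rewrite inE /gap subrr.
have tD : top \notin D.
  apply/negP; rewrite inE => /eqP t0; case/eqP: xn0.
  have z i : gap i0 i x = 0.
    by apply/eqP; rewrite eq_le gmin andbT -t0 -(gap_trans i0 i top) lerDl xle.
  apply: gap_inj => i j; rewrite raddf0.
  by rewrite (gap_base i0 i j) !z subrr.
have [k kD kmin] := arg_minP (fun i => gap i0 i x) (tD : (fun i => i \notin D) top).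
set e := gap i0 k x in kmin.
have e0 : 0 < e by rewrite lt_def gmin andbT; move: kD; rewrite inE.
pose D1 := link_class D i0.
have D1d : is_downset D1 by apply: link_class_downset.
have D1D i : i \in D1 -> i \in D by rewrite inE => /andP[].
have i0D1 : i0 \in D1 by rewrite inE i0D link_refl.
have tD1 : top \notin D1 by apply: contra tD; apply: D1D.
have ys : braid_cone (x - e *: indicator R (~: D1)).
  apply/braid_coneP => i j ij; rewrite raddfB /= linearZ /= gap_indicator !in_setC.
  have [iD1|iD1] := boolP (i \in D1); have [jD1|jD1] := boolP (j \in D1) => /=.
  - by rewrite subrr scaler0 subr0 xs'.
  - have jD : j \notin D.
      apply: contra jD1 => jD; case/setIdP: iD1 => _ i0i.
      by apply/setIdP; split=> //; apply: link_trans i0i (link_le Dd jD (ltW ij)).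
    rewrite subr0 [_ *: _]mulr1 subr_ge0 (le_trans (kmin j jD)) //.
    rewrite -(gap_trans i0 i) gerDr.
    by have := D1D i iD1; rewrite inE => /eqP->.
  - by case/negP: iD1; apply: D1d (ltW ij) jD1.
  - by rewrite subrr scaler0 subr0 xs'.
have uI : u (indicator R (~: D1)) = 0.
  have uI0 := u0 _ (braid_cone_indicator D1d).
  have := u0 _ ys; rewrite linearB linearZ /= ux sub0r oppr_ge0 => H.
  apply/eqP; rewrite eq_le uI0 andbT.
  by rewrite -(pmulr_rle0 _ e0).
have : F (emb (indicator int (~: D1))).
  by apply/FE; rewrite lattice_emb_indicator; split=> //; apply: braid_cone_indicator.
case/Fw=> n nv; exists D1; split=> //.
- exact: link_class_linked.
- by apply/set0Pn; exists i0.
(* The indicator is [n] times [v] and has a gap equal to 1, so [n] is 1. *)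
have /(congr1 absz) : gap i0 top v * n%:Z = 1.
  rewrite -natz mulr_natr -[LHS](raddfMn (gap i0 top)) /= -nv gap_indicator !in_setC.
  by rewrite i0D1 tD1 subr0.
rewrite abszM => /eqP; rewrite muln_eq1 => /andP[_ /eqP n1].
by rewrite nv (_ : n = 1%N).
Qed.

Lemma gorensteinP : gorenstein R P <->
  exists f : P -> int, downset_weight (fun D => top \notin D) f.
Proof.
split=> [[u uP]|[f fP]].
  (* The sign arises because the indicator of [~: D] is minus that of [D] modulo constants. *)
  exists (fun i => - u (indicator int [set i])) => D Dd Dl D0 tD.
  rewrite sumrN -raddf_sum -indicator_sum -raddfN -indicator_setC; apply: uP.
  exact: ray_generator_indicator.
exists (weighted_gap f top) => v /ray_generatorE[D [Dd Dl D0 tD ->]].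
by rewrite /= weighted_gap_indicator // fP.
Qed.

End BraidConeRays.

(** * Iterating the tree quotient *)

Section Iteration.
Local Open Scope order_scope.
Variable d : Order.disp_t.
Implicit Types Q : finPOrderType d.

Lemma intersecting_step Q : intersecting Q <->
  [/\ M_acyclic Q, tree_downset_condition Q & intersecting (tree_quotient Q)].
Proof.
split=> [QI|[ac tdc]].
  split; first exact: intersecting_M_acyclic.
    exact: intersecting_tree_downset_condition.
  exact: intersecting_tree_quotient.
by apply: intersecting_of_tree_quotient => // A T; apply: linked_M_component.
Qed.

Lemma iter_tree_quotientS k Q :
  iter_tree_quotient k.+1 Q = iter_tree_quotient k (tree_quotient Q).
Proof. by elim: k => //= k ->. Qed.

Lemma antichain_intersecting Q : poset_length Q = 0%N -> intersecting Q.
Proof.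
move=> Q0 A B _ _ Al _ x y /setIP[xA _] /setIP[yA _].
have [->|nxy] := eqVneq x y; first exact: link_refl.
have [|||u [v [/set1P-> vA vx xv]]] :=
  linked_cross (S := [set x]) (x := x) Al _ _ yA.
- by rewrite sub1set.
- exact: set11.
- by rewrite inE eq_sym.
have xvc : is_chain [set x; v].
  apply/forall_inP => a aS; apply/forall_inP => b bS; move: aS bS.
  by case/set2P=> -> /set2P[->|->]; rewrite ?comparablexx // comparable_sym.
have := leq_bigmax_cond (F := fun S : {set Q} => #|S|.-1) _ xvc.
by rewrite -/(poset_length Q) Q0 cards2 eq_sym; move: vx; rewrite inE => ->.
Qed.

(** Induction on an upper bound [n] of the length, since the length of the quotient is only bounded
    from above. *)
Lemma intersecting_iter n Q : (poset_length Q <= n)%N ->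
  intersecting Q <-> (forall k, (k < n)%N ->
    M_acyclic (iter_tree_quotient k Q) /\
    tree_downset_condition (iter_tree_quotient k Q)).
Proof.
elim: n Q => [|n IHn] Q Qn.
  by split=> // _; apply: antichain_intersecting; apply/eqP; rewrite -leqn0.
have Qn' : (poset_length (tree_quotient Q) <= n)%N.
  by apply: leq_trans (poset_length_tree_quotient Q) _; case: poset_length Qn.
have IH := IHn _ Qn'; rewrite intersecting_step.
split=> [[ac tdc /IH H] [|k] kn|H]; first by split.
  by rewrite iter_tree_quotientS; apply: H.
have [ac tdc] := H 0%N isT; split=> //; apply/IH => k kn.
by rewrite -iter_tree_quotientS; apply: H.
Qed.

End Iteration.

Theorem theorem5p19 (R : realType) (d : Order.disp_t) (P : finPOrderType d)
    (P_ge2 : (2 <= #|P|)%N)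
    (P_connected : cc [set: P] = 1%N)
    (P_top : exists top : P, forall x : P, (x <= top)%O) :
  gorenstein R P <->
  (forall k : nat, (k < poset_length P)%N ->
     M_acyclic (iter_tree_quotient k P) /\
     tree_downset_condition (iter_tree_quotient k P)).
Proof.
case: P_top => top topP.
rewrite -(intersecting_iter (leqnn _)) (gorensteinP R topP).
split=> [[f fP]|/weight_of_intersecting[f fP]].
  exact: intersecting_of_weight fP.
by exists f => D Dd Dl D0 _; apply: fP.
Qed.
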